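(* Consider the $3$-regular graph game on any finite number $n$ of vertices. Regardless of which player has the first move, a designated player (that is, either one of the two players) has a strategy which ensures, against any play of the opponent, that the graph resulting at the end of the game is planar.
   Context: The $k$-regular graph game on $n$ vertices is the following two-player game. It starts with the empty graph (no edges) on $n$ vertices. The two players alternate turns; on each turn the player to move adds one edge between two distinct vertices which are currently nonadjacent and which each currently have degree at most $k-1$ (so the graph remains simple and all degrees remain at most $k$). Both players have the same available moves. The game ends when no such move is possible; the graph at that time is the resulting graph. A strategy is a rule specifying the player's move as a function of the game so far. *)

(* Defs.v *)
From mathcomp Require Import all_boot all_order all_algebra.
From mathcomp Require Import all_classical all_reals all_analysis.

Set Implicit Arguments.
Unset Strict Implicit.
Unset Printing Implicit Defensive.

Import Order.TTheory GRing.Theory Num.Theory.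
Import numFieldNormedType.Exports.

(* A simple graph on V is given by its set of edges, each edge being the
   two-element set of its ends. *)
Section Game.
Variables (V : finType) (k : nat).
Implicit Types (G : {set {set V}}) (e : {set V}) (s : seq {set V}).

Definition degree G (v : V) : nat := #|[set e in G | v \in e]|.

Definition moves G : {set {set V}} :=
  [set e : {set V} | [&& #|e| == 2, e \notin G
                       & [forall v in e, degree G v < k]]].

(* The game so far is the sequence of the edges added, oldest first. *)
Definition position s : {set {set V}} := [set:: s].

Definition legal_play s : Prop :=
  forall i, i < size s -> nth finset.set0 s i \in moves (position (take i s)).

Definition game_over s : Prop := moves (position s) = finset.set0.

(* The two players are the two booleans. *)
Definition to_move (first : bool) s : bool := first (+) odd (size s).

(* Plays that have ended or in which the opponent is to move are unconstrained:
   the value of the strategy there is never used. *)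
Definition is_strategy (first player : bool) (sigma : seq {set V} -> {set V}) :
    Prop :=
  forall s, legal_play s -> ~ game_over s -> to_move first s = player ->
    sigma s \in moves (position s).

Definition follows (first player : bool) (sigma : seq {set V} -> {set V}) s :
    Prop :=
  forall i, i < size s -> to_move first (take i s) = player ->
    nth finset.set0 s i = sigma (take i s).

End Game.

Local Open Scope ring_scope.

(* Existence of a drawing in the plane: distinct vertices p v, and for each edge
   e an arc gamma e (injective and continuous on [0, 1]) between the two ends of
   e, whose interior contains no vertex and no point of another edge. *)
Definition planar (R : realType) (V : finType) (G : {set {set V}}) : Prop :=
  exists (p : V -> R * R) (gamma : {set V} -> R -> R * R),
    [/\ injective p,
        forall e, e \in G ->
          [/\ {within `[0, 1], continuous (gamma e)}%classic,
              {in `[0, 1] &, injective (gamma e)}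
            & exists u v : V,
                [/\ e = [set u; v], gamma e 0 = p u & gamma e 1 = p v]],
        forall e (t : R) v, e \in G -> t \in `]0, 1[ -> gamma e t <> p v
      & forall e f (s t : R), e \in G -> f \in G -> e <> f ->
          s \in `]0, 1[ -> t \in `]0, 1[ -> gamma e s <> gamma f t].

(* Main.v *)
Require Import Defs.
From mathcomp Require Import all_boot all_order all_algebra.
From mathcomp Require Import all_classical all_reals all_analysis.
From mathcomp Require Import zify ring lra.

(** Say that a vertex of degree d has 3 - d slots, one for each edge that it
    can still receive.  The position is cut into vertex classes that no edge
    leaves.  A class is described by a binary tree whose leaves are its slots
    and which records how freely the class can be drawn: for every word read
    off the leaves after exchanging subtrees at will, the class has a drawing
    in a box, with one loose end running from each slot to the top side, in the
    order of that word ([flexible], [component]).  A lone vertex is a tree with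
    three leaves.

    Two facts make such trees useful.  An edge between two classes grafts their
    trees onto each other at the two slots used ([component_join]).  An edge
    between two slots of one class replaces the path between the two leaves by
    a cycle; when the path has at most three inner nodes, at most three
    branches hang off the cycle, three branches have only two cyclic orders,
    mirror images of each other, and so the outcome is again a tree
    ([component_close]).  A cycle with four branches would be rigid, and this
    is what has to be kept under control.

    The designated player leaves only [safe] positions to the opponent: every
    class has at most four slots, except for at most one class, which has at
    most six.  Suppose the opponent plays an edge.
    - If it joins two classes, it produces at most eight slots in the
      exceptional class, or else possibly a second exceptional class.  The
      reply closes two slots of one class.  This works since a tree with five
      to eight leaves has four leaves whose pairwise paths have at most three
      nodes ([four_close_mid]), and since four slots of a class with more than
      two vertices never consist of pairwise equal or adjacent vertices
      ([no_clique4]).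
    - If it closes two slots of one class, flexibility can only be lost in a
      class with six slots, along a path of four nodes.  The four slots that
      remain contain a legal pair, and whatever pair that is, the class could
      have been drawn beforehand with this pair on one side of the path and the
      other two slots on the other side; so playing it leaves a class with two
      slots ([component_cycle]).
    - If the position is still safe, an exceptional class is reduced as above,
      and when there is none any legal move will do ([free_move]).
    At the end of the game the drawings of the classes are put side by side
    ([state_planar]).

    The drawings are built topologically.  The only pieces used are axis-parallel
    segments: beyond affine maps, every construction prolongs loose ends outside
    a box ([drawn_rot], [drawn_cap], [drawn_cat]). *)

Set Implicit Arguments.
Unset Strict Implicit.
Unset Printing Implicit Defensive.

Import Order.TTheory GRing.Theory Num.Theory.
Import numFieldNormedType.Exports.

(** * Jordan arcs *)

Section Arcs.
Variable R : realType.
Local Open Scope classical_set_scope.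
Local Open Scope ring_scope.
Local Notation pt := (R * R)%type.
Implicit Types (A B : set pt) (a b c z : pt).

(** Continuity is asked on the whole line rather than on [0, 1]: no generality
    is lost, and compositions then need no side condition. *)
Definition jordan_arc A a b := exists g : R -> pt,
  [/\ continuous g, {in `[0, 1] &, injective g}, g 0 = a, g 1 = b
    & A = g @` `[0, 1]].

Lemma arc_start A a b : jordan_arc A a b -> A a.
Proof. by move=> [g [_ _ <- _ ->]]; exists 0 => //=; rewrite in_itv /= lexx ler01. Qed.

Lemma arc_end A a b : jordan_arc A a b -> A b.
Proof. by move=> [g [_ _ _ <- ->]]; exists 1 => //=; rewrite in_itv /= lexx ler01. Qed.

Lemma arc_rev A a b : jordan_arc A a b -> jordan_arc A b a.
Proof.
move=> [g [gc gi g0 g1 ->]]; exists (fun t => g (1 - t)); split.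
- move=> t; apply: continuous_comp; last exact: gc.
  by apply: cvgB; [exact: cvg_cst|exact: cvg_id].
- move=> s t; rewrite !in_itv /= => /andP[s0 s1] /andP[t0 t1] /gi.
  rewrite !in_itv /=.
  have -> : 0 <= 1 - s <= 1 by apply/andP; split; lra.
  have -> : 0 <= 1 - t <= 1 by apply/andP; split; lra.
  by move=> /(_ isT isT); lra.
- by rewrite subr0.
- by rewrite subrr.
- apply/seteqP; split=> z [t]; rewrite /= in_itv /= => /andP[t0 t1] <-.
    exists (1 - t); last by congr g; ring.
    by rewrite /= in_itv /=; apply/andP; split; lra.
  by exists (1 - t) => //; rewrite /= in_itv /=; apply/andP; split; lra.
Qed.

(** Both parametrizations are run one after the other.  Since each is clamped
    at b while the other is running, their sum minus b is the concatenation,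
    and its continuity needs no gluing argument. *)
Lemma arc_cat A B a b c : jordan_arc A a b -> jordan_arc B b c ->
  (forall z, A z -> B z -> z = b) -> jordan_arc (A `|` B) a c.
Proof.
move=> [g [gc gi g0 g1 ->]] [h [hc hi h0 h1 ->]] AB.
pose k t := g (Num.min (2 * t) 1) + h (Num.max (2 * t - 1) 0) - b.
have k1 t : t <= 1/2 -> k t = g (2 * t).
  move=> t2; rewrite /k min_l; last lra.
  by rewrite max_r ?h0 ?addrK //; lra.
have k2 t : 1/2 <= t -> k t = h (2 * t - 1).
  move=> t2; rewrite /k min_r; last lra.
  rewrite g1 max_l; last lra.
  by rewrite addrAC subrr add0r.
have lin t : {for t, continuous (fun x : R => 2 * x)}.
  by apply: cvgM; [exact: cvg_cst|exact: cvg_id].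
exists k; split.
- move=> t; apply: cvgB; last exact: cvg_cst.
  apply: cvgD; apply: continuous_comp; do ?[exact: gc|exact: hc].
    by apply: continuous_min; [exact: lin|exact: cvg_cst].
  apply: continuous_max; last exact: cvg_cst.
  by apply: cvgB; [exact: lin|exact: cvg_cst].
- have cross s t : 0 <= s -> s <= 1/2 -> 1/2 <= t -> t <= 1 -> k s = k t -> s = t.
    move=> s0 s2 t2 t1; rewrite k1 // k2 // => e.
    have gb : g (2 * s) = b.
      apply: AB; first by exists (2 * s) => //=; rewrite in_itv /=; apply/andP; split; lra.
      by rewrite e; exists (2 * t - 1) => //=; rewrite in_itv /=; apply/andP; split; lra.
    have := gi (2 * s) 1; rewrite g1 gb !in_itv /= => /(_ _ _ erefl) es.
    have := hi (2 * t - 1) 0; rewrite h0 -e gb !in_itv /= => /(_ _ _ erefl) et.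
    have {}es : 2 * s = 1 by apply: es; apply/andP; split; lra.
    have {}et : 2 * t - 1 = 0 by apply: et; apply/andP; split; lra.
    lra.
  move=> s t; rewrite !in_itv /= => /andP[s0 s1] /andP[t0 t1] e.
  have [s2|/ltW s2] := leP s (1/2); have [t2|/ltW t2] := leP t (1/2).
  + move: e; rewrite !k1 // => /gi; rewrite !in_itv /= => E.
    have : 2 * s = 2 * t by apply: E; apply/andP; split; lra.
    lra.
  + exact: cross.
  + by apply/esym/cross.
  + move: e; rewrite !k2 // => /hi; rewrite !in_itv /= => E.
    have : 2 * s - 1 = 2 * t - 1 by apply: E; apply/andP; split; lra.
    lra.
- by rewrite k1 ?mulr0 //; lra.
- rewrite k2; last lra.
  by rewrite (_ : 2 * 1 - 1 = 1) //; ring.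
- apply/seteqP; split=> z.
    move=> [] [t]; rewrite /= in_itv /= => /andP[t0 t1] <-.
      exists (t / 2); last by rewrite k1; [congr g; field|lra].
      by rewrite /= in_itv /=; apply/andP; split; lra.
    exists ((t + 1) / 2); last by rewrite k2; [congr h; field|lra].
    by rewrite /= in_itv /=; apply/andP; split; lra.
  move=> [t]; rewrite /= in_itv /= => /andP[t0 t1] <-.
  have [t2|/ltW t2] := leP t (1/2).
    by left; exists (2 * t); rewrite ?k1 //= in_itv /=; apply/andP; split; lra.
  by right; exists (2 * t - 1); rewrite ?k2 //= in_itv /=; apply/andP; split; lra.
Qed.

Lemma arc_map (F : pt -> pt) A a b : continuous F -> injective F ->
  jordan_arc A a b -> jordan_arc (F @` A) (F a) (F b).
Proof.
move=> Fc Fi [g [gc gi <- <- ->]]; exists (F \o g); split=> //.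
- by move=> t; apply: continuous_comp; [exact: gc|exact: Fc].
- by move=> s t si ti /Fi; apply: gi.
- by rewrite image_comp.
Qed.

Definition hseg (x1 x2 y : R) : set pt := [set z | z.2 = y /\ x1 <= z.1 <= x2].
Definition vseg (x y1 y2 : R) : set pt := [set z | z.1 = x /\ y1 <= z.2 <= y2].

Definition affine (p q r s : R) (z : pt) : pt := (p * z.1 + q, r * z.2 + s).

Lemma affine_continuous p q r s : continuous (affine p q r s).
Proof.
move=> z.
have cf : z'.1 @[z' --> z] --> z.1 by exact: cvg_fst.
have cs : z'.2 @[z' --> z] --> z.2 by exact: cvg_snd.
have c1 : p * z'.1 + q @[z' --> z] --> p * z.1 + q.
  by apply: cvgD; [apply: cvgM; [exact: cvg_cst|]|exact: cvg_cst].
have c2 : r * z'.2 + s @[z' --> z] --> r * z.2 + s.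
  by apply: cvgD; [apply: cvgM; [exact: cvg_cst|]|exact: cvg_cst].
exact: cvg_pair c1 c2.
Qed.

Lemma affine_inj p q r s : p != 0 -> r != 0 -> injective (affine p q r s).
Proof.
by move=> p0 r0 [x y] [x' y'] [/addIr /(mulfI p0) /= -> /addIr /(mulfI r0) /= ->].
Qed.

Lemma arc_line a b : a != b ->
  jordan_arc [set z | exists2 t, 0 <= t <= 1 & z = (a.1 + t * (b.1 - a.1), a.2 + t * (b.2 - a.2))] a b.
Proof.
case: a b => [a1 a2] [b1 b2] /= ab.
exists (fun t => (a1 + t * (b1 - a1), a2 + t * (b2 - a2))); split.
- have lin p q : continuous (fun t : R => p + t * q).
    move=> t; apply: cvgD; first exact: cvg_cst.
    by apply: cvgM; [exact: cvg_id|exact: cvg_cst].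
  by move=> t; exact: cvg_pair (lin _ _ t) (lin _ _ t).
- move=> s t _ _ [/addrI e1 /addrI e2].
  have [e|n] := eqVneq b1 a1; last by apply: (mulIf _ e1); rewrite subr_eq0.
  apply: (mulIf _ e2); rewrite subr_eq0.
  by apply: contraNneq ab => ->; rewrite e.
- by congr pair; ring.
- by congr pair; ring.
- by apply/seteqP; split=> z [t /= h e]; exists t => //; rewrite ?in_itv // e.
Qed.

Lemma arc_hseg x1 x2 y : x1 < x2 -> jordan_arc (hseg x1 x2 y) (x1, y) (x2, y).
Proof.
move=> x12; have := @arc_line (x1, y) (x2, y); rewrite /=.
have -> : [set z | exists2 t : R, 0 <= t <= 1
   & z = (x1 + t * (x2 - x1), y + t * (y - y))] = hseg x1 x2 y.
  apply/seteqP; split=> [z [t /andP[t0 t1] ->]|[z1 z2] [/= -> /andP[h1 h2]]].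
    split=> /=; first by ring.
    apply/andP; split; nra.
  have p : 0 < x2 - x1 by lra.
  exists ((z1 - x1) / (x2 - x1)); last by congr pair; field; lra.
  by rewrite ler_pdivlMr // ler_pdivrMr //; apply/andP; split; lra.
by apply; apply/eqP => -[]; lra.
Qed.

Lemma arc_vseg x y1 y2 : y1 < y2 -> jordan_arc (vseg x y1 y2) (x, y1) (x, y2).
Proof.
move=> y12; pose F (z : pt) : pt := (z.2, z.1).
have -> : vseg x y1 y2 = F @` hseg y1 y2 x.
  apply/seteqP; split=> [[z1 z2] [/= -> h]|_ [[z1 z2] [/= -> h] <-]] //.
  by exists (z2, x).
apply: (@arc_map F _ (y1, x) (y2, x)); last exact: arc_hseg.
  move=> z.
  have cf : z'.1 @[z' --> z] --> z.1 by exact: cvg_fst.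
  have cs : z'.2 @[z' --> z] --> z.2 by exact: cvg_snd.
  exact: cvg_pair cs cf.
by move=> [? ?] [? ?] [-> ->].
Qed.

End Arcs.

(** * Sketches: drawings with loose ends *)

Section Sketches.
Variables (R : realType) (V : finType).
Local Open Scope classical_set_scope.
Local Notation pt := (R * R)%type.
Local Notation curve := ({set V} + nat)%type.
Implicit Types (S : {set V}) (G : {set {set V}}) (w : seq V).
Implicit Types (B : set pt) (t : nat -> pt) (p : V -> pt) (C : curve -> set pt).

(** The curves of a sketch are the edges inside S, and one loose end for each
    position of the word w. *)
Definition live S G w (c : curve) : bool :=
  match c with inl e => (e \in G) && (e \subset S) | inr i => i < size w end.

Definition meets w (c : curve) (v : V) : Prop :=
  match c with inl e => v \in e | inr i => nth v w i = v end.

(** A drawing, inside the region B, of the edges within S, together with loose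
    ends: the one for the i-th letter of w starts at that vertex and stops at
    t i, just outside B.  Treating edges and loose ends alike as curves that
    meet only in vertices lets one clause [sk_cross] say everything about
    crossings. *)
Record sketch S G w B t p C : Prop := Sketch {
  sk_inj : {in S &, injective p};
  sk_pt : forall v, v \in S -> B (p v);
  sk_meet : forall c v, live S G w c -> v \in S -> C c (p v) -> meets w c v;
  sk_cross : forall c d z, live S G w c -> live S G w d -> c <> d ->
    C c z -> C d z -> exists2 v, v \in S & z = p v;
  sk_edgeB : forall e, e \in G -> e \subset S -> C (inl e) `<=` B;
  sk_edge : forall e, e \in G -> e \subset S -> exists u v : V,
    e = [set u; v]%SET /\ jordan_arc (C (inl e)) (p u) (p v);
  sk_word : forall v, v \in w -> v \in S;
  sk_end : forall i, i < size w -> ~ B (t i);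
  sk_stubB : forall i, i < size w -> C (inr i) `<=` B `|` [set t i];
  sk_stub : forall i v, i < size w -> jordan_arc (C (inr i)) (p (nth v w i)) (t i) }.

Lemma sketch_sub S G w B B' t p C : sketch S G w B t p C -> B `<=` B' ->
  (forall i, i < size w -> ~ B' (t i)) -> sketch S G w B' t p C.
Proof.
move=> [inj ptB mt cr eB ed wS en sB st] BB' en'; split=> //.
- by move=> v vS; apply/BB'/ptB.
- by move=> e eG eS z /eB h; apply/BB'/h.
- by move=> i iw z /sB [] //; [left; exact: BB'|right].
Qed.

Lemma sketch_ends S G w B t t' p C : sketch S G w B t p C ->
  (forall i, i < size w -> t i = t' i) -> sketch S G w B t' p C.
Proof.
move=> [inj ptB mt cr eB ed wS en sB st] tt'; split=> // i.
- by move=> iw; rewrite -tt' //; exact: en.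
- by move=> iw; rewrite -tt' //; exact: sB.
- by move=> v iw; rewrite -tt' //; exact: st.
Qed.

Lemma sketch_map S G w B t p C (F : pt -> pt) : continuous F -> injective F ->
  sketch S G w B t p C ->
  sketch S G w (F @` B) (F \o t) (F \o p) (fun c => F @` C c).
Proof.
move=> Fc Fi [inj ptB mt cr eB ed wS en sB st].
have img A z : (F @` A) (F z) -> A z by move=> [z' Az' /Fi <-].
split.
- by move=> u v uS vS /Fi; apply: inj.
- by move=> v vS; exists (p v) => //; exact: ptB.
- by move=> c v lc vS /img; apply: mt.
- move=> c d z lc ld cd [z1 C1 e1] [z2 C2 e2].
  have e : z1 = z2 by apply: Fi; rewrite e1 e2.
  rewrite -{}e in C2; have [v vS zv] := cr c d z1 lc ld cd C1 C2.
  by exists v => //=; rewrite -zv.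
- by move=> e eG eS _ [z Cz <-]; exists z => //; exact: eB Cz.
- move=> e eG eS; have [u [v [euv a]]] := ed e eG eS.
  by exists u, v; split=> //; exact: arc_map.
- exact: wS.
- by move=> i iw /img; exact: en.
- move=> i iw _ [z Cz <-]; case: (sB i iw z Cz) => [Bz|->]; last by right.
  by left; exists z.
- by move=> i v iw; exact/arc_map/st.
Qed.

(** A prolonged loose end is still an arc, since it meets its prolongation only
    in t i: the rest of it lies in B, where no prolongation goes. *)
Lemma sketch_extend S G w B t p C B' t' (D : nat -> set pt) :
  sketch S G w B t p C ->
  (forall i, i < size w -> jordan_arc (D i) (t i) (t' i)) ->
  (forall i z, i < size w -> D i z -> ~ B z) ->
  (forall i j z, i < size w -> j < size w -> D i z -> D j z -> i = j) ->
  B `<=` B' -> (forall i, i < size w -> D i `<=` B' `|` [set t' i]) ->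
  (forall i, i < size w -> ~ B' (t' i)) ->
  sketch S G w B' t' p
    (fun c => match c with inl e => C c | inr i => C c `|` D i end).
Proof.
move=> [inj ptB mt cr eB ed wS en sB st] Da DB DD BB' DB' en'.
have CD i j z : i < size w -> j < size w -> C (inr i) z -> D j z -> i = j /\ z = t i.
  move=> iw jw Cz Dz; case: (sB i iw z Cz) => [Bz|zt].
    by case: (DB _ _ jw Dz).
  by split=> //; apply: (DD i j z) => //; rewrite zt; exact: arc_start (Da _ iw).
have eD e i z : e \in G -> e \subset S -> i < size w -> C (inl e) z -> D i z -> False.
  by move=> eG eS iw /(eB _ eG eS) Bz /(DB _ _ iw).
split=> //.
- by move=> v vS; apply/BB'/ptB.
- case=> [e|i] v lc vS; first exact: mt.
  by case=> [|/(DB _ _ lc) []]; [exact: mt|exact: ptB].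
- case=> [e|i] [f|j] z lc ld cd.
  + exact: cr.
  + case/andP: (lc) => eG eS Ce [Cj|]; first exact: cr Ce Cj.
    by move/(eD _ _ _ eG eS ld Ce).
  + case/andP: (ld) => eG eS [Ci|Di] Cf; first exact: cr Ci Cf.
    by case: (eD _ _ _ eG eS lc Cf Di).
  + have ij : i <> j by move=> ij; apply: cd; rewrite ij.
    case=> [Ci|Di] [Cj|Dj]; first exact: cr Ci Cj.
    * by case: (CD _ _ _ lc ld Ci Dj).
    * by case: (CD _ _ _ ld lc Cj Di) => ji; case: ij.
    * by case: ij; exact: DD Di Dj.
- by move=> e eG eS z /eB h; apply/BB'/h.
- move=> i iw z [|/(DB' _ iw)] //.
  move=> Cz; case: (sB i iw z Cz) => [/BB'|->]; first by left.
  by apply: (DB' _ iw); exact: arc_start (Da _ iw).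
- move=> i v iw; apply: arc_cat (st i v iw) (Da _ iw) _ => z Cz Dz.
  by case: (CD _ _ _ iw iw Cz Dz).
Qed.

(** The two loose ends used up can meet only in a vertex, and that vertex would
    have to be both x and y; so they form an arc together with D. *)
Lemma sketch_cap S G x y w B t p C B' D :
  sketch S G (x :: y :: w) B t p C -> x != y -> jordan_arc D (t 0) (t 1) ->
  (forall z, D z -> ~ B z) ->
  B `<=` B' -> D `<=` B' ->
  (forall i, i < size w -> ~ B' (t i.+2)) ->
  sketch S ([set x; y]%SET |: G)%SET w B' (fun i => t i.+2) p
    (fun c => match c with
      | inl e => if e == [set x; y]%SET then C (inr 0) `|` D `|` C (inr 1) else C c
      | inr i => C (inr i.+2) end).
Proof.
move=> [inj ptB mt cr eB ed wS en sB st] xy Da DB BB' DB' en'.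
have w0 : 0 < size [:: x, y & w] by [].
have w1 : 1 < size [:: x, y & w] by [].
have xS : x \in S by apply: wS; rewrite !inE eqxx.
have yS : y \in S by apply: wS; rewrite !inE eqxx orbT.
pose old c : curve := match c with inl e => inl e | inr i => inr i.+2 end.
(* Every curve but the new edge is one of the given curves, [old c]. *)
pose isnew (c : curve) := c == inl [set x; y]%SET.
have lold c : live S ([set x; y]%SET |: G)%SET w c -> ~~ isnew c ->
    live S G [:: x, y & w] (old c).
  by case: c => [e|i] //=; rewrite !inE => /andP[/orP[|->//]] /eqP -> _ /eqP.
have oldD c z : live S G [:: x, y & w] (old c) -> C (old c) z -> D z -> False.
  case: c => [e|i] /=; first by move=> /andP[eG eS] /(eB _ eG eS) Bz /DB.
  move=> iw Cz Dz; case: (sB i.+2 iw z Cz) => [/DB|zt]; first exact.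
  by apply: (en' i iw); rewrite -zt; exact: DB'.
have newold c z : live S G [:: x, y & w] (old c) -> C (old c) z ->
    (C (inr 0) `|` D `|` C (inr 1)) z -> exists2 v, v \in S & z = p v.
  move=> lc Cz [[C0|Dz]|C1].
  - by apply: (cr (old c) (inr 0) z) => //; case: (c).
  - by case: (oldD _ _ lc Cz Dz).
  - by apply: (cr (old c) (inr 1) z) => //; case: (c).
split=> //.
- by move=> v vS; apply/BB'/ptB.
- case=> [e|i] v lc vS; last exact: (mt (inr i.+2)).
  case: ifPn => [/eqP -> |ne].
    case=> [[C0|Dv]|C1] /=; rewrite !inE.
    + by have /= -> := mt (inr 0) v w0 vS C0; rewrite eqxx.
    + by case: (DB _ Dv); exact: ptB.
    + by have /= -> := mt (inr 1) v w1 vS C1; rewrite eqxx orbT.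
  by apply: (mt (inl e)) => //; apply: (lold (inl e)).
- move=> c d z lc ld cd.
  have E c' : (match c' with
      | inl e => if e == [set x; y]%SET then C (inr 0) `|` D `|` C (inr 1) else C c'
      | inr i => C (inr i.+2) end) =
      if isnew c' then C (inr 0) `|` D `|` C (inr 1) else C (old c').
    by case: c' => [e|i] //=; rewrite /isnew /=.
  rewrite !E; have [nc|nc] := boolP (isnew c); have [nd|nd] := boolP (isnew d).
  + by case: cd; rewrite (eqP nc) (eqP nd).
  + by move=> Cc Cd; exact: newold (lold _ ld nd) Cd Cc.
  + by move=> Cc Cd; exact: newold (lold _ lc nc) Cc Cd.
  + apply: cr; [exact: lold|exact: lold|].
    by case: (c) (d) cd => [e|i] [f|j] //= cd [] E'; apply: cd; rewrite E'.
- move=> e; rewrite !inE; case: eqP => [_ _ _|_ /= eG eS z /(eB _ eG eS)]; last exact: BB'.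
  have tB' i : i < 2 -> B' (t i).
    case: i => [|[|//]] _; apply: DB'; [exact: arc_start Da|exact: arc_end Da].
  move=> z [[C0|/DB' //]|C1].
    by case: (sB 0 w0 z C0) => [/BB' //|->]; exact: tB'.
  by case: (sB 1 w1 z C1) => [/BB' //|->]; exact: tB'.
- move=> e; rewrite !inE; case: eqP => [-> _ _|_]; last exact: ed.
  exists x, y; split=> //.
  have a0 := st 0 x w0; have a1 := st 1 x w1.
  apply: arc_cat (arc_rev a1) _; first apply: arc_cat a0 Da _.
    move=> z C0 Dz; case: (sB 0 w0 z C0) => [/DB|//]; exact.
  move=> z [C0|Dz] C1.
    have [//|v vS zv] := cr (inr 0) (inr 1) z w0 w1 _ C0 C1.
    rewrite zv in C0 C1; have /= vx := mt (inr 0) v w0 vS C0; have /= vy := mt (inr 1) v w1 vS C1.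
    by case/eqP: xy; rewrite vx vy.
  by case: (sB 1 w1 z C1) => [/DB|//]; exact.
- by move=> v vw; apply: wS; rewrite !inE vw !orbT.
- by move=> i iw z Cz; case: (sB i.+2 iw z Cz); [left; exact: BB'|right].
- by move=> i v iw; exact: (st i.+2 v).
Qed.

(** Only the numbering of the loose ends changes; their geometric order along
    the boundary is restored in [drawn_rot]. *)
Lemma sketch_shift S G x w B t p C : sketch S G (x :: w) B t p C ->
  sketch S G (rcons w x) B
    (fun i => if i < size w then t i.+1 else t 0) p
    (fun c => match c with inl e => C c
      | inr i => C (inr (if i < size w then i.+1 else 0)) end).
Proof.
move=> [inj ptB mt cr eB ed wS en sB st].
pose s i := if i < size w then i.+1 else 0.
have -> : (fun i => if i < size w then t i.+1 else t 0) = t \o s.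
  by apply/funext => i; rewrite /s /=; case: ifP.
have sw i : i < size (rcons w x) -> s i < size (x :: w).
  by rewrite /s size_rcons /=; case: ifP.
have ns i v : i < size (rcons w x) -> nth v (rcons w x) i = nth v (x :: w) (s i).
  by rewrite /s size_rcons nth_rcons ltnS; case: ltngtP.
have si i j : i < size (rcons w x) -> j < size (rcons w x) -> s i = s j -> i = j.
  rewrite /s size_rcons => iw jw.
  by case: (ltnP i) => h; case: (ltnP j) => h'; lia.
pose o (c : curve) : curve := match c with inl e => inl e | inr i => inr (s i) end.
have lo c : live S G (rcons w x) c -> live S G (x :: w) (o c).
  by case: c => //= i /sw.
have -> : (fun c : curve => match c with inl e => C c
      | inr i => C (inr (if i < size w then i.+1 else 0)) end) = C \o o.
  by apply/funext => -[].
split=> //=.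
- move=> [e|i] v lc vS Cv; first exact: mt Cv.
  by rewrite /= ns //; exact: (mt (inr (s i)) v (sw _ lc)).
- move=> c d z lc ld cd; apply: cr; try exact: lo.
  by case: (c) (d) lc ld cd => [e|i] [f|j] //= lc ld cd [] E; apply: cd;
     rewrite ?E // (si i j).
- by move=> v; rewrite mem_rcons; exact: wS.
- by move=> i /sw; exact: en.
- by move=> i /sw; exact: sB.
- by move=> i v iw; rewrite ns //; exact: st (sw _ iw).
Qed.

Lemma sketch_cat S1 S2 G w1 w2 B1 B2 B t1 t2 p1 p2 C1 C2 :
  sketch S1 G w1 B1 t1 p1 C1 -> sketch S2 G w2 B2 t2 p2 C2 ->
  (forall v, v \in S1 -> v \in S2 -> False) ->
  (forall e, e \in G -> e \subset (S1 :|: S2)%SET -> e \subset S1 \/ e \subset S2) ->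
  (forall z, B1 z -> ~ B2 z) -> B1 `<=` B -> B2 `<=` B ->
  (forall i, i < size w1 -> ~ B (t1 i)) -> (forall i, i < size w2 -> ~ B (t2 i)) ->
  (forall i j, i < size w1 -> j < size w2 -> t1 i <> t2 j) ->
  sketch (S1 :|: S2)%SET G (w1 ++ w2) B
    (fun i => if i < size w1 then t1 i else t2 (i - size w1))
    (fun v => if v \in S1 then p1 v else p2 v)
    (fun c => match c with
      | inl e => if e \subset S1 then C1 c else C2 c
      | inr i => if i < size w1 then C1 c else C2 (inr (i - size w1)) end).
Proof.
move=> [inj1 pt1 mt1 cr1 eB1 ed1 wS1 en1 sB1 st1].
move=> [inj2 pt2 mt2 cr2 eB2 ed2 wS2 en2 sB2 st2] dS eS B12 BB1 BB2 en1' en2' t12.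
have S2N v : v \in S2 -> (v \in S1) = false.
  by move=> v2; apply/negbTE/negP => v1; exact: dS v1 v2.
pose p v := if v \in S1 then p1 v else p2 v.
have pE1 v : v \in S1 -> p v = p1 v by rewrite /p => ->.
have pE2 v : v \in S2 -> p v = p2 v by rewrite /p => /S2N ->.
pose C (c : curve) := match c with
      | inl e => if e \subset S1 then C1 c else C2 c
      | inr i => if i < size w1 then C1 c else C2 (inr (i - size w1)) end.
rewrite -/p -/C.
pose T1 := B1 `|` [set z | exists2 i, i < size w1 & z = t1 i].
pose T2 := B2 `|` [set z | exists2 i, i < size w2 & z = t2 i].
have T12 z : T1 z -> T2 z -> False.
  move=> [b1|[i iw ->]] [b2|[j jw e]].
  - exact: B12 b1 b2.
  - by apply: (en2' j jw); rewrite -e; exact: BB1.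
  - by apply: (en1' i iw); exact: BB2.
  - exact: t12 e.
(* Every live curve is a live curve of exactly one of the two sketches *)
have side c : live (S1 :|: S2)%SET G (w1 ++ w2) c ->
    (exists d, [/\ live S1 G w1 d, C c = C1 d, C1 d `<=` T1, 
       (forall v, v \in S1 -> meets w1 d v -> meets (w1 ++ w2) c v) &
       match c, d with inl e, inl f => e = f | inr i, inr j => i = j | _, _ => False end])
  \/ (exists d, [/\ live S2 G w2 d, C c = C2 d, C2 d `<=` T2, 
       (forall v, v \in S2 -> meets w2 d v -> meets (w1 ++ w2) c v) &
       match c, d with inl e, inl f => e = f | inr i, inr j => i = (size w1 + j)%N | _, _ => False end]).
  case: c => [e|i] /=.
    move=> /andP[eG /(eS _ eG)]; rewrite /C; have [e1 _|ne [//|e2]] := boolP (e \subset S1).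
      left; exists (inl e); split=> //=; first by rewrite eG.
      by move=> z /(eB1 _ eG e1); left.
    right; exists (inl e); split=> //=; first by rewrite eG.
    by move=> z /(eB2 _ eG e2); left.
  rewrite size_cat /C; have [i1 _|i1 i2] := ltnP i (size w1).
    left; exists (inr i); split=> //=.
      by move=> z /(sB1 _ i1) [|->]; [left|right; exists i].
    by move=> v vS; rewrite nth_cat i1.
  have i2' : i - size w1 < size w2 by lia.
  right; exists (inr (i - size w1)%N); split=> //=.
  - by move=> z /(sB2 _ i2') [|->]; [left|right; exists (i - size w1)%N].
  - by move=> v vS; rewrite nth_cat ltnNge i1.
  - by rewrite subnKC.
have pT v : v \in (S1 :|: S2)%SET ->
    (v \in S1 /\ p v = p1 v /\ T1 (p v)) \/ (v \in S2 /\ p v = p2 v /\ T2 (p v)).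
  rewrite inE => /orP[v1|v2]; [left|right].
    by rewrite pE1 //; do 2!split=> //; left; exact: pt1.
  by rewrite pE2 //; do 2!split=> //; left; exact: pt2.
split.
- move=> u v /pT [[u1 [uE uT]]|[u2 [uE uT]]] /pT [[v1 [vE vT]]|[v2 [vE vT]]] E.
  + by apply: inj1; rewrite // -uE -vE.
  + by case: (T12 _ uT); rewrite E.
  + by case: (T12 _ vT); rewrite -E.
  + by apply: inj2; rewrite // -uE -vE.
- by move=> v /pT [] [vS [-> _]]; [apply/BB1/pt1|apply/BB2/pt2].
- move=> c v /side [[d [ld -> CT mt _]]|[d [ld -> CT mt _]]] /pT.
    move=> [[v1 [-> _]]|[v2 [vE vT]]] Cv; first by apply: mt => //; exact: mt1 Cv.
    by case: (T12 (p v)) => //; exact: CT.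
  move=> [[v1 [vE vT]]|[v2 [-> _]]] Cv; last by apply: mt => //; exact: mt2 Cv.
  by case: (T12 (p v)) => //; exact: CT.
- move=> c d z /side [[c' [lc -> cT _ cE]]|[c' [lc -> cT _ cE]]];
    move=> /side [[d' [ld -> dT _ dE]]|[d' [ld -> dT _ dE]]] cd Cz Dz.
  + have [|v v1 ->] := cr1 c' d' z lc ld _ Cz Dz; last by exists v; rewrite ?inE ?v1 ?pE1.
    by move=> E; case: cd; move: cE dE; rewrite E; case: (c) (d) (d') => [?|?] [?|?] [?|?] //= -> ->.
  + by case: (T12 z); [exact: cT|exact: dT].
  + by case: (T12 z); [exact: dT|exact: cT].
  + have [|v v1 ->] := cr2 c' d' z lc ld _ Cz Dz; last by exists v; rewrite ?inE ?v1 ?orbT ?pE2.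
    by move=> E; case: cd; move: cE dE; rewrite E; case: (c) (d) (d') => [?|?] [?|?] [?|?] //= -> ->.
- move=> e eG eSS; rewrite /C; case: ifPn => [e1|ne] z Cz; first exact/BB1/(eB1 e).
  by apply/BB2/(eB2 e) => //; case: (eS e eG eSS) ne => // ->.
- move=> e eG eSS; rewrite /C.
  have sub u v (T : {set V}) : e = [set u; v]%SET -> e \subset T -> u \in T /\ v \in T.
    by move=> ->; rewrite finset.subUset !finset.sub1set => /andP.
  case: ifPn => [e1|ne].
    have [u [v [E a]]] := ed1 e eG e1; exists u, v; split=> //.
    by have [u1 v1] := sub _ _ _ E e1; rewrite !pE1.
  have e2 : e \subset S2 by case: (eS e eG eSS) ne => // ->.
  have [u [v [E a]]] := ed2 e eG e2; exists u, v; split=> //.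
  by have [u2 v2] := sub _ _ _ E e2; rewrite !pE2.
- by move=> v; rewrite mem_cat inE => /orP[/wS1 ->|/wS2 ->]; rewrite ?orbT.
- by move=> i; rewrite size_cat; case: (ltnP i (size w1)) => [i1 _|i1 i2];
    [exact: en1'|apply: en2'; lia].
- move=> i; rewrite size_cat /C; case: (ltnP i (size w1)) => [i1 _|i1 i2] z.
    by move=> /(sB1 _ i1) [/BB1|]; [left|right].
  by have i2' : i - size w1 < size w2 by [lia]; move=> /(sB2 _ i2') [/BB2|]; [left|right].
- move=> i v; rewrite size_cat /C nth_cat; case: (ltnP i (size w1)) => [i1 _|i1 i2].
    by rewrite pE1; [exact: st1|exact/wS1/mem_nth].
  have i2' : i - size w1 < size w2 by lia.
  by rewrite pE2; [exact: st2|exact/wS2/mem_nth].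
Qed.

End Sketches.

(** * Drawings in a box *)

Section Drawings.
Variables (R : realType) (V : finType).
Local Open Scope classical_set_scope.
Local Open Scope ring_scope.
Local Notation pt := (R * R)%type.
Implicit Types (S : {set V}) (G : {set {set V}}) (w : seq V).

Definition box (x1 x2 y1 y2 : R) : set pt :=
  [set z | x1 < z.1 < x2 /\ y1 < z.2 < y2].

(** The loose ends arrive at the top side of the unit box from left to right, in
    the order of w.  Only this order matters, so that drawings can be
    combined freely. *)
Definition drawn S G w : Prop := exists p C (X : nat -> R),
  [/\ sketch S G w (box 0 1 0 1) (fun i => (X i, 1)) p C,
      forall i, (i < size w)%N -> 0 < X i < 1
    & forall i j, (i < j < size w)%N -> X i < X j].

Lemma sketch_affine S G w x1 x2 y1 y2 x1' x2' y1' y2' t t' p C (a b c d : R) :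
  sketch S G w (box x1 x2 y1 y2) t p C -> 0 < a -> 0 < c ->
  a * x1 + b = x1' -> a * x2 + b = x2' -> c * y1 + d = y1' -> c * y2 + d = y2' ->
  (forall i, (i < size w)%N -> affine a b c d (t i) = t' i) ->
  (forall i, (i < size w)%N -> ~ box x1' x2' y1' y2' (t' i)) ->
  exists p' C', sketch S G w (box x1' x2' y1' y2') t' p' C'.
Proof.
move=> sk a0 c0 ex1 ex2 ey1 ey2 et nb.
exists (affine a b c d \o p), (fun e => affine a b c d @` C e).
apply: (sketch_ends _ et); apply: sketch_sub (sketch_map _ _ sk) _ _.
- exact: affine_continuous.
- by apply: affine_inj; lra.
- move=> _ [[z1 z2] [/= /andP[h1 h2] /andP[h3 h4]] <-].
  by split; apply/andP; split=> /=; nra.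
- by move=> i iw /=; rewrite et //; exact: nb.
Qed.

(** The box is shrunk to the middle of the unit box, and the leftmost loose end
    is led around it, counterclockwise below the shrunk box, to become the
    rightmost one. *)
Lemma drawn_rot S G x w : drawn S G (x :: w) -> drawn S G (rcons w x).
Proof.
move=> [p [C [X [sk X01 Xlt]]]].
have X0 := X01 0 isT.
have XS i : (i < size w)%N -> X 0 < X i.+1 < 1.
  by move=> iw; rewrite Xlt //=; have /andP[] := X01 i.+1 iw.
have [|||||||| p' [C' sk']] := @sketch_affine _ _ _ 0 1 0 1 (1/3) (2/3) (1/3) (2/3) _
    (fun i => ((X i + 1) / 3, 2/3)) _ _ (1/3) (1/3) (1/3) (1/3) sk; try by lra.
- by move=> i _; rewrite /affine /=; congr pair; field.
- by move=> i _ [_ /=] /andP[]; lra.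
have {}sk' := sketch_shift sk'.
pose a := (X 0%N + 1) / 3.
have a0 : 1/3 < a < 2/3 by rewrite /a; lra.
(* The detour: left along the top of the shrunk box, down, right, and up. *)
pose A := hseg (1/6) a (2/3) `|` vseg (1/6) (1/6) (2/3) `|`
  hseg (1/6) (5/6) (1/6) `|` vseg (5/6) (1/6) 1.
pose D i := if (i < size w)%N then vseg ((X i.+1 + 1) / 3) (2/3) 1 else A.
pose X' i := if (i < size w)%N then (X i.+1 + 1) / 3 else 5/6 : R.
exists p'; eexists; exists X'; split; first apply: (sketch_extend (D := D)) sk' _ _ _ _ _ _.
- move=> i _; rewrite /D /X'; case: ifP => _; first by apply: arc_vseg; lra.
  rewrite -/a /A; apply: arc_cat (arc_vseg _ _) _; [|lra|].
    apply: arc_cat (arc_hseg _ _) _; [|lra|].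
      apply: arc_cat (arc_rev (arc_hseg _ _)) (arc_rev (arc_vseg _ _)) _; [lra|lra|].
      by move=> [z1 z2] [/= h1 h2] [/= h3 h4]; congr pair; lra.
    by move=> [z1 z2] [] [/= h1 h2] [/= h3 h4]; congr pair; lra.
  by move=> [z1 z2] [[]|] [/= h1 h2] [/= h3 h4]; congr pair; lra.
- move=> i [z1 z2] _; rewrite /D; case: ifP => iw.
    by move=> [/= _ ?] [/= _ ?]; lra.
  by move=> [[[]|]|] [/= h1 h2] [/= h3 h4]; lra.
- have DA i z : (i < size w)%N -> D i z -> A z -> False.
    case: z => z1 z2 iw; rewrite /D iw; have := XS i iw.
    by move=> ? [/= h1 h2] [[[]|]|] [/= h3 h4]; move: h1 h2 h3 h4; rewrite /a; lra.
  move=> i j z; rewrite !size_rcons => iw jw.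
  have [iw'|iw'] := ltnP i (size w); have [jw'|jw'] := ltnP j (size w).
  + rewrite /D iw' jw' => -[e1 _] [e2 _].
    have e : X i.+1 = X j.+1 by lra.
    have [ij|ij|//] := ltngtP i j.
      by have := Xlt i.+1 j.+1; rewrite /= !ltnS ij jw' e ltxx => /(_ isT).
    by have := Xlt j.+1 i.+1; rewrite /= !ltnS ij iw' e ltxx => /(_ isT).
  + by move=> Di; rewrite {1}/D ltnNge jw' /= => /(DA i z iw' Di).
  + by rewrite {1}/D ltnNge iw' /= => Az Dj; case: (DA j z jw' Dj Az).
  + by move=> _ _; lia.
- by move=> [z1 z2] [/= h1 h2]; split=> /=; lra.
- move=> i _ [z1 z2]; rewrite /D /X'; case: ifPn => iw.
    have := XS i iw; move=> ? [/= h1 h2].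
    have [h|h] := ltP z2 1; first by left; split=> /=; lra.
    by right=> /=; congr pair; lra.
  have [h|h] := ltP z2 1.
    by move=> [[[]|]|] [/= h1 h2]; left; split=> /=; lra.
  by move=> [[[]|]|] [/= h1 h2]; try (by exfalso; lra); right=> /=; congr pair; lra.
- by move=> i _ [_ /=]; lra.
- move=> i _; rewrite /X'; case: ifPn => iw; last by lra.
  by have := XS i iw; lra.
- move=> i j; rewrite size_rcons => ij; rewrite /X'.
  have -> : (i < size w)%N by lia.
  have iw : (i < size w)%N by lia.
  case: ifPn => jw; last by have := XS i iw; lra.
  by have := Xlt i.+1 j.+1; rewrite /= !ltnS (_ : (i < j < size w)%N); last lia; move=> /(_ isT); lra.
Qed.

(** The two leftmost loose ends are neighbours on the top side of the box, so a
    horizontal segment connects them and meets nothing else. *)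
Lemma drawn_cap S G x y w : x != y -> drawn S G (x :: y :: w) ->
  drawn S ([set x; y]%SET |: G)%SET w.
Proof.
move=> xy [p [C [X [sk X01 Xlt]]]].
have X1 : X 0 < X 1%N by exact: Xlt.
have XS i : (i < size w)%N -> X 1%N < X i.+2 by move=> iw; exact: Xlt.
have [|||||||| p' [C' sk']] := @sketch_affine _ _ _ 0 1 0 1 0 1 0 (1/2) _
    (fun i => (X i, 1/2)) _ _ 1 0 (1/2) 0 sk; try by lra.
- by move=> i _; rewrite /affine /=; congr pair; field.
- by move=> i _ [_ /=] /andP[]; lra.
have X00 := X01 0 isT; have X10 := X01 1%N isT.
have {}sk' := sketch_cap (B' := box 0 1 0 (1/2) `|` hseg (X 0) (X 1%N) (1/2)) sk' xy
  (arc_hseg (1/2) X1).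
have P1 z : hseg (X 0) (X 1%N) (1/2) z -> ~ box 0 1 0 (1/2) z.
  by case: z => z1 z2 [/= h1 h2] [/= h3 h4]; lra.
have P2 i : (i < size w)%N ->
    ~ (box 0 1 0 (1/2) `|` hseg (X 0) (X 1%N) (1/2)) (X i.+2, 1/2).
  by move=> iw; have := XS i iw; move=> ? [] [/= h1 h2]; lra.
have {}sk' := sk' P1 (@subsetUl _ _ _) (@subsetUr _ _ _) P2.
exists p'; eexists; exists (fun i => X i.+2); split.
  apply: (sketch_extend (D := fun i => vseg (X i.+2) (1/2) 1)) sk' _ _ _ _ _ _.
  - by move=> i _; apply: arc_vseg; lra.
  - by move=> i [z1 z2] iw; have := XS i iw; move=> ? [/= h1 h2] [] [/= h3 h4]; lra.
  - move=> i j [z1 z2] iw jw [/= h1 h2] [/= h3 h4].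
    have [ij|ij|//] := ltngtP i j.
      by have := Xlt i.+2 j.+2; rewrite /= !ltnS ij jw -h1 -h3 ltxx => /(_ isT).
    by have := Xlt j.+2 i.+2; rewrite /= !ltnS ij iw -h1 -h3 ltxx => /(_ isT).
  - by move=> [z1 z2] [] [/= h1 h2]; split=> /=; lra.
  - move=> i iw [z1 z2] [/= h1 h2]; have := X01 i.+2 iw => ?.
    have [h|h] := ltP z2 1; first by left; split=> /=; lra.
    by right=> /=; congr pair; lra.
  - by move=> i _ [_ /=]; lra.
- by move=> i iw; exact: X01.
- by move=> i j ij; apply: Xlt; rewrite /= !ltnS.
Qed.

Lemma drawn_cat S1 S2 G w1 w2 : drawn S1 G w1 -> drawn S2 G w2 ->
  (forall v, v \in S1 -> v \in S2 -> False) ->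
  (forall e, e \in G -> e \subset (S1 :|: S2)%SET -> e \subset S1 \/ e \subset S2) ->
  drawn (S1 :|: S2)%SET G (w1 ++ w2).
Proof.
move=> [p1 [C1 [X1 [sk1 X1b X1lt]]]] [p2 [C2 [X2 [sk2 X2b X2lt]]]] dS eS.
have [|||||||| p1' [C1' sk1']] := @sketch_affine _ _ _ 0 1 0 1 0 (1/2) 0 1 _
    (fun i => (X1 i / 2, 1)) _ _ (1/2) 0 1 0 sk1; try by lra.
- by move=> i _; rewrite /affine /=; congr pair; field.
- by move=> i _ [_ /=] /andP[]; lra.
have [|||||||| p2' [C2' sk2']] := @sketch_affine _ _ _ 0 1 0 1 (1/2) 1 0 1 _
    (fun i => ((X2 i + 1) / 2, 1)) _ _ (1/2) (1/2) 1 0 sk2; try by lra.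
- by move=> i _; rewrite /affine /=; congr pair; field.
- by move=> i _ [_ /=] /andP[]; lra.
pose X i := if (i < size w1)%N then X1 i / 2 else (X2 (i - size w1)%N + 1) / 2.
have {}sk := sketch_cat (B := box 0 1 0 1) sk1' sk2' dS eS.
eexists; eexists; exists X; split.
- apply: sketch_ends (sk _ _ _ _ _ _) _.
  + by move=> [z1 z2] [/= h1 h2] [/= h3 h4]; lra.
  + by move=> [z1 z2] [/= h1 h2]; split=> /=; lra.
  + by move=> [z1 z2] [/= h1 h2]; split=> /=; lra.
  + by move=> i _ [_ /=]; lra.
  + by move=> i _ [_ /=]; lra.
  + by move=> i j /X1b h1 /X2b h2 [] h; lra.
  + by move=> i _; rewrite /X; case: ifP.
- move=> i; rewrite size_cat /X; case: (ltnP i (size w1)) => [/X1b ? _|i1 i2]; first by lra.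
  have /X2b : (i - size w1 < size w2)%N by lia.
  lra.
- move=> i j; rewrite size_cat /X => ij.
  case: (ltnP i (size w1)) => i1; case: (ltnP j (size w1)) => j1.
  + have : X1 i < X1 j by apply: X1lt; lia.
    lra.
  + have := X1b i i1; have /X2b : (j - size w1 < size w2)%N by lia.
    lra.
  + lia.
  + have : X2 (i - size w1)%N < X2 (j - size w1)%N by apply: X2lt; lia.
    lra.
Qed.

Lemma drawn0 G : (forall e : {set V}, e \in G -> e != finset.set0) ->
  drawn finset.set0 G [::].
Proof.
move=> G0.
have nG e : e \in G -> e \subset finset.set0 -> False.
  by move=> /G0 /negP e0; rewrite finset.subset0 => /e0.
exists (fun=> (0, 0)), (fun=> set0), (fun=> 0).
split=> //; last by move=> i j /=; rewrite andbF.
split=> //.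
- by move=> v; rewrite finset.in_set0.
- by move=> v; rewrite finset.in_set0.
- by move=> e /nG h /h.
Qed.

Lemma drawn_sub S G G' w : drawn S G w ->
  (forall e, e \in G' -> e \subset S -> e \in G) -> drawn S G' w.
Proof.
move=> [p [C [X [[inj ptB mt cr eB ed wS en sB st] X01 Xlt]]]] G'G.
exists p, C, X; split=> //.
have live_sub c : live S G' w c -> live S G w c.
  by case: c => //= e /andP[eG' eS]; rewrite eS (G'G e eG' eS).
split=> //.
- by move=> c v /live_sub; exact: mt.
- by move=> c d z /live_sub lc /live_sub; exact: cr.
- by move=> e /G'G eG eS; apply: eB => //; exact: eG.
- by move=> e /G'G eG eS; apply: ed => //; exact: eG.
Qed.

Lemma drawn1 G v : (forall e : {set V}, e \in G -> (1 < #|e|)%N) ->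
  drawn [set v]%SET G [:: v; v; v].
Proof.
move=> G2.
have nG e : e \in G -> e \subset [set v]%SET -> False.
  by move=> /G2 e2 /subset_leq_card; rewrite cards1 leqNgt e2.
pose X i : R := if i is 0%N then 1/4 else if i is 1%N then 1/2 else 3/4.
pose T i : set pt := match i with
  | 0%N => hseg (1/4) (1/2) (1/2) `|` vseg (1/4) (1/2) 1
  | 1%N => vseg (1/2) (1/2) 1
  | _ => hseg (1/2) (3/4) (1/2) `|` vseg (3/4) (1/2) 1 end.
have T_arc i : jordan_arc (T i) (1/2, 1/2) (X i, 1).
  case: i => [|[|i]] /=; last 1 first.
  - apply: arc_cat (arc_hseg _ _) (arc_vseg _ _) _; [lra|lra|].
    by move=> [z1 z2] [/= h1 h2] [/= h3 h4]; congr pair; lra.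
  - apply: arc_cat (arc_rev (arc_hseg _ _)) (arc_vseg _ _) _; [lra|lra|].
    by move=> [z1 z2] [/= h1 h2] [/= h3 h4]; congr pair; lra.
  - by apply: arc_vseg; lra.
have T_cross i j z : (i < j < 3)%N -> T i z -> T j z -> z = (1/2, 1/2).
  case: z => z1 z2; case: i j => [|[|i]] [|[|j]] //= ij; last by lia.
  - by move=> [] [/= h1 h2] [/= h3 h4]; congr pair; lra.
  - by move=> [] [/= h1 h2] [] [/= h3 h4]; congr pair; lra.
  - by move=> [/= h1 h2] [] [/= h3 h4]; congr pair; lra.
pose C (c : {set V} + nat) : set pt := if c is inr i then T i else set0.
pose p (_ : V) : pt := (1/2, 1/2).
exists p, C, X.
have X01 i : 0 < X i < 1 by case: i => [|[|i]] /=; lra.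
split; last first.
- by move=> [|[|i]] [|[|j]] //= ij; [lra|lra|lra|lia].
- by move=> i _; exact: X01.
split.
- by move=> x y; rewrite !inE => /eqP -> /eqP ->.
- by move=> x _; split=> /=; lra.
- case=> [e|i] x /=; first by move=> /andP[/nG h /h].
  move=> i3; rewrite inE => /eqP -> _.
  by case: i i3 => [|[|[|]]].
- move=> [e|i] [f|j] z //= i3 j3 ij Ti Tj; try by case/andP: (i3) => /nG h /h.
  exists v; rewrite ?inE //.
  have [h|h|h] := ltngtP i j; last by case: ij; rewrite h.
    by apply: T_cross Ti Tj; rewrite h.
  by apply: T_cross Tj Ti; rewrite h.
- by move=> e /nG h /h.
- by move=> e /nG h /h.
- by move=> x; rewrite !inE; do 2!case: eqP => // ->.
- by move=> i _ [_ /=]; lra.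
- move=> i _ [z1 z2] /=; have := X01 i => Xi.
  have [h|h] := ltP z2 1.
    by case: i Xi => [|[|i]] /= Xi; do ?[case]; move=> /= h1 h2; left; split=> /=; lra.
  by case: i Xi => [|[|i]] /= Xi; do ?[case]; move=> /= h1 h2; right=> /=; congr pair; lra.
- move=> i x i3; have -> : nth x [:: v; v; v] i = v by case: i i3 => [|[|[|]]].
  exact: T_arc.
Qed.

(** Loose ends are forgotten.  An interior point of an edge cannot be a vertex:
    the vertex would be an end of that edge, against injectivity; and two edges
    meet only in vertices. *)
Lemma drawn_planar G w : (forall e : {set V}, e \in G -> (1 < #|e|)%N) ->
  drawn [set: V]%SET G w -> planar R G.
Proof.
move=> G2 [p [C [X [[inj ptB mt cr eB ed wS en sB st] _ _]]]].
have ga e : exists g : R -> pt, e \in G -> 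
    [/\ continuous g, {in `[0, 1] &, injective g}, C (inl e) = g @` `[0, 1] &
     exists u v : V, [/\ e = [set u; v]%SET, g 0 = p u & g 1 = p v]].
  have [eG|_] := boolP (e \in G); last by exists (fun=> (0, 0)).
  have [u [v [euv [g [gc gi g0 g1 Cg]]]]] := ed e eG (finset.subsetT e).
  by exists g => _; split=> //; exists u, v.
have {}ga := choice ga; case: ga => gamma gaP.
have live e : e \in G -> live [set: V]%SET G w (inl e).
  by move=> eG /=; rewrite eG finset.subsetT.
have I01 (t : R) : t \in `]0, 1[ -> t \in `[0, 1] /\ t <> 0 /\ t <> 1.
  by rewrite !in_itv /= => /andP[h1 h2]; split; [apply/andP; split; lra|split; lra].
have i0 : (0 : R) \in `[0, 1] by rewrite in_itv /= lexx ler01.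
have i1 : (1 : R) \in `[0, 1] by rewrite in_itv /= lexx ler01.
have novertex e (t : R) v : e \in G -> t \in `]0, 1[ -> gamma e t <> p v.
  move=> eG /I01 [t01 [t0 t1]] gp.
  have [_ gi Cg [x [y [exy g0 g1]]]] := gaP e eG.
  have : C (inl e) (p v) by rewrite Cg; exists t.
  move/(mt _ _ (live e eG) (finset.in_setT v)) => /=.
  rewrite exy !inE => /orP[]/eqP vE; rewrite vE -?g0 -?g1 in gp.
    by apply: t0; exact: gi gp.
  by apply: t1; exact: gi gp.
exists p, gamma; split=> //.
- by move=> x y; apply: inj; rewrite finset.in_setT.
- move=> e eG; have [gc gi _ ends] := gaP e eG; split=> //.
  exact: continuous_subspaceT.
- move=> e f s t eG fG ef s01 t01 st'.
  have [|||v _ zv] := cr (inl e) (inl f) (gamma e s) (live e eG) (live f fG).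
  + by case.
  + by have [_ _ Cg _] := gaP e eG; rewrite Cg; exists s => //; have [] := I01 s s01.
  + by have [_ _ Cg _] := gaP f fG; rewrite st' Cg; exists t => //; have [] := I01 t t01.
  + by case: (novertex e s v).
Qed.

End Drawings.

(** * Trees of slots *)

Section Trees.
Variable T : eqType.
Implicit Types (x y : T) (w : seq T).

Inductive tree := Bare | Leaf of T | Node of tree & tree.
Implicit Types (t l r : tree).

Fixpoint leaves t : seq T :=
  match t with Bare => [::] | Leaf x => [:: x] | Node l r => leaves l ++ leaves r end.

(** The words read off the leaves of t after exchanging the two subtrees at any
    set of nodes. *)
Fixpoint front t w : Prop :=
  match t with
  | Bare => w = [::]
  | Leaf x => w = [:: x]
  | Node l r => exists w1 w2, [/\ front l w1, front r w2 & w = w1 ++ w2 \/ w = w2 ++ w1]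
  end.

Lemma front_leaves t : front t (leaves t).
Proof. by elim: t => //= l hl r hr; exists (leaves l), (leaves r); split=> //; left. Qed.

Lemma front_left l r w1 w2 : front l w1 -> front r w2 -> front (Node l r) (w1 ++ w2).
Proof. by move=> h1 h2; exists w1, w2; split=> //; left. Qed.

Lemma front_right l r w1 w2 : front l w1 -> front r w2 -> front (Node l r) (w2 ++ w1).
Proof. by move=> h1 h2; exists w1, w2; split=> //; right. Qed.

(** t' is read off in no more ways than t; unlike [reroot], this relation is a
    congruence. *)
Definition flips t t' : Prop :=
  perm_eq (leaves t) (leaves t') /\ forall w, front t' w -> front t w.

(** Words matter only up to rotation, because drawings can be rotated; so the
    choice of the edge where the tree is rooted does not matter.  This is
    [reroot_assoc]. *)
Definition reroot t t' : Prop := perm_eq (leaves t) (leaves t') /\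
  forall w, front t' w -> exists2 w', front t w' & exists n, w = rot n w'.

Lemma flips_refl t : flips t t.
Proof. by []. Qed.

Lemma flips_trans t2 t1 t3 : flips t1 t2 -> flips t2 t3 -> flips t1 t3.
Proof. by move=> [p1 h1] [p2 h2]; split=> [|w /h2/h1 //]; exact: perm_trans p2. Qed.

Lemma flips_comm l r : flips (Node l r) (Node r l).
Proof.
split=> [|w [w1 [w2 [h1 h2 h]]]]; first by rewrite /= perm_catC.
by exists w2, w1; split=> //; case: h; [right|left].
Qed.

Lemma flips_node l l' r r' : flips l l' -> flips r r' -> flips (Node l r) (Node l' r').
Proof.
move=> [p1 h1] [p2 h2]; split=> [|w [w1 [w2 [/h1 f1 /h2 f2 h]]]].
  exact: perm_cat.
by exists w1, w2.
Qed.

Lemma flips_pad l t : leaves l = [::] -> flips (Node l t) t.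
Proof.
move=> l0; split=> [|w f]; first by rewrite /= l0.
have := front_leaves l; rewrite l0 => f0.
exact: (front_left f0 f).
Qed.

Lemma flips_bare t : flips t (Node Bare t).
Proof. by split=> // w [_ [w2 [-> f [] ->]]]; rewrite ?cats0. Qed.

Lemma flips_leaf t x : leaves t = [:: x] -> flips t (Leaf x).
Proof. by move=> tx; split=> [|w ->]; [rewrite tx|rewrite -tx; exact: front_leaves]. Qed.

Lemma flips_reroot t t' : flips t t' -> reroot t t'.
Proof. by move=> [p h]; split=> // w /h f; exists w => //; exists 0; rewrite rot0. Qed.

Lemma rot_rot w n m : exists k, rot n (rot m w) = rot k w.
Proof.
have [hm|hm] := leqP m (size w); last first.
  by exists n; rewrite [rot m w]rot_oversize // ltnW.
have [hn|hn] := leqP n (size w); last first.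
  by exists m; rewrite rot_oversize // size_rot ltnW.
by eexists; apply: rot_add_mod.
Qed.

Lemma reroot_trans t2 t1 t3 : reroot t1 t2 -> reroot t2 t3 -> reroot t1 t3.
Proof.
move=> [p1 h1] [p2 h2]; split=> [|w /h2 [w' /h1 [w'' f [m ->]] [n ->]]].
  exact: perm_trans p2.
by exists w'' => //; exact: rot_rot.
Qed.

Lemma reroot_flips t2 t1 t3 : reroot t1 t2 -> flips t2 t3 -> reroot t1 t3.
Proof. by move=> h /flips_reroot; exact: reroot_trans. Qed.

Lemma reroot_assoc a b c : reroot (Node (Node a b) c) (Node a (Node b c)).
Proof.
split=> [|w [wa [wbc [fa [wb [wc [fb fc h']]] h]]]]; first by rewrite /= catA.
have ab := front_left fa fb; have ba := front_right fa fb.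
case: h' h => -> [] ->.
- by exists ((wa ++ wb) ++ wc); [exact: front_left|exists 0; rewrite rot0 catA].
- exists ((wa ++ wb) ++ wc); first exact: front_left.
  by exists (size wa); rewrite -(catA wa) rot_size_cat.
- exists (wc ++ (wb ++ wa)); first exact: front_right.
  by exists (size (wc ++ wb)); rewrite (catA wc) rot_size_cat.
- by exists (wc ++ (wb ++ wa)); [exact: front_right|exists 0; rewrite rot0 -catA].
Qed.

(** Moving the root towards x turns any tree into one that is rooted at x. *)
Lemma extract x t r : x \in leaves t ->
  exists t', reroot (Node t r) (Node (Leaf x) t').
Proof.
elim: t r => [|y|a ha b hb] r //=.
  by rewrite inE => /eqP ->; exists r; exact/flips_reroot/flips_refl.
rewrite mem_cat => /orP[/ha|/hb] h.
  by have [t' h'] := h (Node b r); exists t'; apply: reroot_trans (reroot_assoc _ _ _) h'.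
have [t' h'] := h (Node a r); exists t'; apply: reroot_trans h'.
apply: reroot_trans (reroot_assoc _ _ _); apply: flips_reroot.
by apply: flips_node (flips_comm _ _) (flips_refl _).
Qed.

Lemma extract_leaf x t : x \in leaves t -> exists t', reroot t (Node (Leaf x) t').
Proof.
move=> /(extract Bare) [t' h]; exists t'; apply: reroot_trans h.
by apply/flips_reroot/(flips_trans (flips_bare t))/flips_comm.
Qed.

(** The path from the root to the leaf y, with the branches bs hanging off its
    successive nodes. *)
Definition comb (bs : seq tree) y := foldr Node (Leaf y) bs.

Lemma leaf_comb y t : y \in leaves t -> exists bs,
  [/\ flips t (comb bs y) & all (fun b => 0 < size (leaves b)) bs].
Proof.
have step l r : (exists bs, [/\ flips r (comb bs y) & all (fun b => 0 < size (leaves b)) bs]) ->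
  exists bs, [/\ flips (Node l r) (comb bs y) & all (fun b => 0 < size (leaves b)) bs].
  move=> [bs [f h]]; case l0 : (leaves l) => [|x s].
    by exists bs; split=> //; apply: flips_trans f; exact: flips_pad.
  exists (l :: bs); split; last by rewrite /= l0.
  exact: flips_node (flips_refl _) f.
elim: t => //= [x|l hl r hr].
  by rewrite inE => /eqP ->; exists [::]; split=> //; exact: flips_refl.
rewrite mem_cat => /orP[/hl|/hr] h; last exact: step.
have [bs [f h']] := step r l h; exists bs; split=> //.
exact: flips_trans (flips_comm _ _) f.
Qed.

(** The path from x to y has at most three nodes; fewer nodes are allowed for
    by bare branches. *)
Definition closable x y t : Prop := exists b1 b2 b3,
  reroot t (Node (Leaf x) (comb [:: b1; b2; b3] y)).

Lemma comb_pad3 bs y : size bs <= 3 -> exists b1 b2 b3,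
  flips (comb bs y) (comb [:: b1; b2; b3] y).
Proof.
case: bs => [|b1 [|b2 [|b3 []]]] //= _;
  [exists Bare, Bare, Bare|exists b1, Bare, Bare|exists b1, b2, Bare|exists b1, b2, b3];
  do ?[apply: flips_node (flips_refl _) _];
  do ?[apply: (flips_trans (flips_bare _)); apply: flips_node (flips_refl _) _];
  exact: flips_refl.
Qed.

Lemma size_comb bs y : all (fun b => 0 < size (leaves b)) bs ->
  size bs < size (leaves (comb bs y)) /\
  (size (leaves (comb bs y)) <= (size bs).+1 -> all (fun b => size (leaves b) == 1) bs).
Proof.
elim: bs => //= b bs IH /andP[b0 /IH [h1 h2]]; rewrite size_cat; split; first by lia.
by move=> h; rewrite h2 ?andbT; lia.
Qed.

(** A path with four nodes or more has at least four branches, hence accounts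
    for all the leaves of a tree with six leaves, and each branch is a leaf. *)
Lemma closable_or_cycle x y t : x != y -> x \in leaves t -> y \in leaves t ->
  size (leaves t) <= 6 ->
  closable x y t \/ exists a b c d, reroot t (Node (Leaf x)
     (comb [:: Leaf a; Leaf b; Leaf c; Leaf d] y)) /\ size (leaves t) = 6.
Proof.
move=> xy xt yt t6; have [t' tt'] := extract_leaf xt.
have yt' : y \in leaves t'.
  by move: yt; case: tt' => /perm_mem -> _; rewrite /= inE eq_sym (negPf xy).
have [bs [f h]] := leaf_comb yt'.
have [s1 s2] := size_comb y h.
have {}f : reroot t (Node (Leaf x) (comb bs y)).
  exact: reroot_flips tt' (flips_node (flips_refl _) f).
have sz : size (leaves t) = (size (leaves (comb bs y))).+1.
  by case: f => /perm_size ->.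
have [b3|b4] := leqP (size bs) 3.
  left; have [b1 [b2 [b3' fb]]] := comb_pad3 y b3.
  by exists b1, b2, b3'; exact: reroot_flips f (flips_node (flips_refl _) fb).
have b4' : size bs = 4 by lia.
have {}s2 := s2 ltac:(lia).
right; case: bs {h s1 b4} b4' s2 f sz => [|b1 [|b2 [|b3 [|b4 []]]]] // _ /and5P[h1 h2 h3 h4 _] f sz.
have one b : size (leaves b) == 1 -> exists a, flips b (Leaf a).
  by case E : (leaves b) => [|a []] // _; exists a; exact: flips_leaf.
have [a fa] := one _ h1; have [b fb] := one _ h2; have [c fc] := one _ h3; have [d fd] := one _ h4.
exists a, b, c, d; split; last by rewrite sz /= !size_cat (eqP h1) (eqP h2) (eqP h3) (eqP h4).
by apply: reroot_flips f _; do ?[apply: flips_node => //].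
Qed.

Lemma closable_small x y t : x != y -> x \in leaves t -> y \in leaves t ->
  size (leaves t) <= 5 -> closable x y t.
Proof.
move=> xy xt yt t5.
case: (closable_or_cycle xy xt yt) => [|//|[a [b [c [d [_ e]]]]]]; lia.
Qed.

(** * Pairs of leaves with a short path between them *)

Lemma closable_twins x y r t : reroot t (Node (Node (Leaf x) (Leaf y)) r) -> closable x y t.
Proof.
move=> h; exists r, Bare, Bare; apply: reroot_trans h _.
apply: reroot_flips (reroot_assoc _ _ _) _; apply: flips_node (flips_refl _) _.
apply: flips_trans (flips_comm _ _) _; apply: flips_node (flips_refl _) _.
apply: flips_trans (flips_bare _) _; apply: flips_node (flips_refl _) _.
exact: flips_bare.
Qed.

(** The leaf x hangs off the top node of X, or is X itself; two such leaves in
    different branches of a node are [closable]. *)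
Definition shallow x X := exists X', flips X (Node (Leaf x) X').

Lemma closable_shallow x y X Y Z t : reroot t (Node X (Node Y Z)) ->
  shallow x X -> shallow y Y -> closable x y t.
Proof.
move=> h [X' fX] [Y' fY]; exists X', Z, Y'; apply: reroot_trans h _.
apply: (@reroot_trans (Node (Node (Leaf x) X') (Node Z (Node Y' (Leaf y))))).
  apply/flips_reroot/flips_node => //; apply: flips_trans (flips_comm _ _) _.
  by apply: flips_node (flips_refl _) (flips_trans fY (flips_comm _ _)).
exact: reroot_assoc.
Qed.

Lemma shallow_leaf x : shallow x (Leaf x).
Proof. by exists Bare; apply: flips_trans (flips_bare _) (flips_comm _ _). Qed.

Lemma shallow_l x r : shallow x (Node (Leaf x) r).
Proof. by exists r. Qed.

Lemma shallow_r x l : shallow x (Node l (Leaf x)).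
Proof. by exists l; exact: flips_comm. Qed.

Lemma reroot_cycle X Y Z : reroot (Node X (Node Y Z)) (Node Y (Node Z X)).
Proof. by apply: reroot_trans (flips_reroot (flips_comm _ _)) (reroot_assoc _ _ _). Qed.

Lemma reroot_swap X Y Z : reroot (Node X (Node Y Z)) (Node X (Node Z Y)).
Proof. exact/flips_reroot/flips_node/flips_comm. Qed.

Definition four_close t := exists a b c d s, perm_eq (leaves t) [:: a, b, c, d & s] /\
  [/\ closable a b t, closable a c t, closable a d t &
   [/\ closable b c t, closable b d t & closable c d t]].

Lemma four_close_pairs a b c d r t :
  reroot t (Node (Node (Leaf a) (Leaf b)) (Node (Node (Leaf c) (Leaf d)) r)) -> four_close t.
Proof.
move=> h; have h' := reroot_trans h (reroot_cycle _ _ _).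
exists a, b, c, d, (leaves r); split; first by case: h.
have al := shallow_l a (Leaf b); have br := shallow_r b (Leaf a).
have cl := shallow_l c (Leaf d); have dr := shallow_r d (Leaf c).
split; [exact: closable_twins h| | |split; last exact: closable_twins h'];
  exact: closable_shallow h _ _.
Qed.

Lemma four_close_star a b c d Y Z t : reroot t (Node (Node (Leaf a) (Leaf b)) (Node Y Z)) ->
  shallow c Y -> shallow d Z -> four_close t.
Proof.
move=> h sc sd; have h1 := reroot_trans h (reroot_swap _ _ _).
have h2 := reroot_trans h (reroot_cycle _ _ _).
have al := shallow_l a (Leaf b); have br := shallow_r b (Leaf a).
have [Y' [pY _]] := sc; have [Z' [pZ _]] := sd.
exists a, b, c, d, (leaves Y' ++ leaves Z'); split.
  have [p _] := h; apply: perm_trans p _; apply/permP => P.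
  move/permP/(_ P): pY; move/permP/(_ P): pZ; rewrite /= !count_cat /=; lia.
split; [exact: closable_twins h|exact: closable_shallow h _ _|exact: closable_shallow h1 _ _|split].
- exact: closable_shallow h _ _.
- exact: closable_shallow h1 _ _.
- exact: closable_shallow h2 _ _.
Qed.

(** Bare subtrees are only padding.  In a pure tree they do not occur, and the
    number of leaves determines the shape of small trees. *)
Fixpoint pure t := match t with Bare => false | Leaf _ => true | Node l r => pure l && pure r end.

Lemma prune t : 0 < size (leaves t) -> exists2 t', pure t' & flips t t'.
Proof.
elim: t => //= [x _|l hl r hr]; first by exists (Leaf x) => //; exact: flips_refl.
rewrite size_cat; case El : (leaves l) hl => [|x s] hl.
  by move=> /hr [r' pr fr]; exists r' => //; apply: flips_trans fr; exact: flips_pad.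
have [l' pl fl] := hl isT; case Er : (leaves r) hr => [|y s'] hr.
  move=> _; exists l' => //; apply: flips_trans (flips_comm _ _) _.
  by apply: flips_trans fl; exact: flips_pad.
have [r' pr fr] := hr isT; exists (Node l' r'); first by rewrite /= pl.
exact: flips_node.
Qed.

Lemma pure_gt0 t : pure t -> 0 < size (leaves t).
Proof. by elim: t => //= l hl r hr /andP[/hl ? _]; rewrite size_cat; lia. Qed.

Lemma pure1 t : pure t -> size (leaves t) = 1 -> exists x, t = Leaf x.
Proof.
case: t => //= [x|l r]; first by exists x.
by move=> /andP[/pure_gt0 ? /pure_gt0 ?]; rewrite size_cat; lia.
Qed.

Lemma pure2 t : pure t -> size (leaves t) = 2 -> exists x y, t = Node (Leaf x) (Leaf y).
Proof.
case: t => //= l r /andP[pl pr]; rewrite size_cat => s.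
have gl := pure_gt0 pl; have gr := pure_gt0 pr.
have [x ->] := pure1 pl ltac:(lia); have [y ->] := pure1 pr ltac:(lia).
by exists x, y.
Qed.

(** Descend from the root of t for as long as one half has at least three
    leaves; the descent ends at a fork of two halves with at most two leaves. *)
Lemma minimal_fork t r : pure t -> 3 <= size (leaves t) -> exists a b r',
  [/\ pure a /\ pure b, size (leaves a) <= 2, size (leaves b) <= 2,
      3 <= size (leaves a) + size (leaves b) & reroot (Node t r) (Node (Node a b) r')].
Proof.
elim: t r => //= a ha b hb r /andP[pa pb]; rewrite size_cat => s.
have [a2|a3] := leqP (size (leaves a)) 2; last first.
  have [a' [b' [r' [p sa sb sab h]]]] := ha (Node b r) pa a3.
  by exists a', b', r'; split=> //; apply: reroot_trans (reroot_assoc _ _ _) h.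
have [b2|b3] := leqP (size (leaves b)) 2; last first.
  have [a' [b' [r' [p sa sb sab h]]]] := hb (Node a r) pb b3.
  exists a', b', r'; split=> //; apply: reroot_trans _ h.
  apply: reroot_trans (reroot_assoc _ _ _); apply: flips_reroot.
  by apply: flips_node (flips_comm _ _) (flips_refl _).
by exists a, b, r; split=> //; exact/flips_reroot/flips_refl.
Qed.

Lemma shallow_big t : pure t -> 2 <= size (leaves t) <= 3 -> exists x, shallow x t.
Proof.
case: t => //= l r /andP[pl pr]; rewrite size_cat => s.
have gl := pure_gt0 pl; have gr := pure_gt0 pr.
have [l1|l2] := leqP (size (leaves l)) 1.
  by have [x ->] := pure1 pl ltac:(lia); exists x; exact: shallow_l.
by have [x ->] := pure1 pr ltac:(lia); exists x; exact: shallow_r.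
Qed.

(** Look at a smallest subtree with at least three leaves.  If both its halves
    have two leaves, these four will do.  Otherwise it is ((a b) c), and the
    rest u' is a fork of v1 and v2.  A leaf among v1 and v2 completes a, b, c.  If
    there is none, at most five leaves are left for v1 and v2, so the smaller
    one is a pair (d e), the other one has a shallow leaf f, and c, d, e, f will
    do.  The bound eight is what excludes larger v1 and v2. *)
Lemma four_close_mid t : 5 <= size (leaves t) <= 8 -> four_close t.
Proof.
move=> t58; have [t1 p1 f1] := @prune t ltac:(lia).
have s1 : size (leaves t1) = size (leaves t) by case: f1 => /perm_size.
have [l [r [u [[pl pr] sl sr slr h]]]] := @minimal_fork t1 Bare p1 ltac:(lia).
have {}h : reroot t (Node (Node l r) u).
  apply: reroot_trans h; apply: reroot_flips (flips_reroot f1) _.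
  exact: flips_trans (flips_bare _) (flips_comm _ _).
have sz : size (leaves t) = size (leaves l) + size (leaves r) + size (leaves u).
  by case: h => /perm_size -> _; rewrite /= !size_cat.
have [u' pu fu] := @prune u ltac:(lia).
have su : size (leaves u') = size (leaves u) by case: fu => /perm_size.
have {}h : reroot t (Node (Node l r) u').
  exact: reroot_flips h (flips_node (flips_refl _) fu).
have gl := pure_gt0 pl; have gr := pure_gt0 pr.
wlog l2 : l r pl pr sl sr slr h sz gl gr / size (leaves l) = 2.
  move=> W; have [l2|l1] := eqVneq (size (leaves l)) 2; first exact: (W l r).
  apply: (W r l) => //; try lia.
  by apply: reroot_flips h _; apply: flips_node (flips_comm _ _) (flips_refl _).
have [a [b ab]] := pure2 pl l2.
have [r2|r1] := leqP 2 (size (leaves r)).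
  have [c [d cd]] := pure2 pr ltac:(lia).
  by apply: (@four_close_pairs a b c d u'); rewrite -ab -cd; apply: reroot_trans h (reroot_assoc _ _ _).
have [c Ec] := pure1 pr ltac:(lia).
case: u' pu su {fu} h => //= [x|v1 v2] pu; rewrite ?size_cat => su h; first by rewrite /= in su; lia.
case/andP: pu => pv1 pv2; have g1 := pure_gt0 pv1; have g2 := pure_gt0 pv2.
wlog v12 : v1 v2 pv1 pv2 g1 g2 su h / size (leaves v1) <= size (leaves v2).
  move=> W; have [v12|v12] := leqP (size (leaves v1)) (size (leaves v2)); first exact: (W v1 v2).
  by apply: (W v2 v1) => //; [lia|exact: reroot_trans h (reroot_swap _ _ _)|lia].
have [v1s|v1b] := leqP (size (leaves v1)) 1.
  have [d Ed] := pure1 pv1 ltac:(lia).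
  apply: (@four_close_star a b c d r (Node v1 v2)).
  - by rewrite -ab; apply: reroot_trans h (reroot_assoc _ _ _).
  - by rewrite Ec; exact: shallow_leaf.
  - by rewrite Ed; exact: shallow_l.
have [d [e de]] := pure2 pv1 ltac:(lia).
have [f sf] := @shallow_big v2 pv2 ltac:(lia).
apply: (@four_close_star d e f c v2 (Node l r)) => //.
  by rewrite -de; apply: reroot_trans h (reroot_cycle _ _ _).
by rewrite Ec; exact: shallow_r.
Qed.

(** * Families of words described by trees *)

Definition flexible (D : seq T -> Prop) t := forall w, front t w -> D w.

Lemma flexible_reroot (D : seq T -> Prop) t t' :
  (forall n w, D w -> D (rot n w)) -> reroot t t' -> flexible D t -> flexible D t'.
Proof. by move=> rD [_ h] f w /h [w' /f d [n ->]]; exact: rD. Qed.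

Lemma flexible_join (D1 D2 D : seq T -> Prop) x y t1 t2 :
  (forall n w, D w -> D (rot n w)) ->
  (forall w1 w2, D1 (rcons w1 x) -> D2 (y :: w2) -> D (w1 ++ w2)) ->
  flexible D1 (Node (Leaf x) t1) -> flexible D2 (Node (Leaf y) t2) ->
  flexible D (Node t1 t2).
Proof.
move=> rD J f1 f2 w [w1 [w2 [h1 h2 h]]].
have K : D (w1 ++ w2).
  apply: J; first by rewrite -cats1; apply: f1; exact: front_right.
  by apply: f2; exact: (@front_left (Leaf y) _ [:: y]).
by case: h => -> //; have := rD (size w1) _ K; rewrite rot_size_cat.
Qed.

(** The four leaves on the path may be put on either side of it.  For every two
    of them there is a word that shows these two next to each other on one
    side, and the other two on the other side. *)
Lemma flexible_cycle (D : seq T -> Prop) x y a b c d :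
  flexible D (Node (Leaf x) (comb [:: Leaf a; Leaf b; Leaf c; Leaf d] y)) ->
  [/\ D [:: x; c; d; y; b; a], D [:: x; b; d; y; c; a], D [:: x; b; c; y; d; a] &
   [/\ D [:: x; a; d; y; c; b], D [:: x; a; c; y; d; b] & D [:: x; a; b; y; d; c]]].
Proof.
have L z t w : front t w -> front (Node (Leaf z) t) (z :: w).
  by move=> f; exact: (@front_left (Leaf z) t [:: z]).
have R z t w : front t w -> front (Node (Leaf z) t) (rcons w z).
  by move=> f; rewrite -cats1; exact: (@front_right (Leaf z) t [:: z]).
move=> f; split; last split; apply/f/L.
- by apply: (R a _ [:: c; d; y; b]); apply: (R b _ [:: c; d; y]); do 2!apply/L.
- by apply: (R a _ [:: b; d; y; c]); apply/L; apply: (R c _ [:: d; y]); apply/L.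
- by apply: (R a _ [:: b; c; y; d]); do 2!apply/L; apply: (R d _ [:: y]).
- by apply/L; apply: (R b _ [:: d; y; c]); apply: (R c _ [:: d; y]); apply/L.
- by apply/L; apply: (R b _ [:: c; y; d]); apply/L; apply: (R d _ [:: y]).
- by do 2!apply/L; apply: (R c _ [:: y; d]); apply: (R d _ [:: y]).
Qed.

(** Closing the path from x to y leaves the branches b1, b2, b3 around a cycle.
    The words with x first and y last give the cyclic order b1 b2 b3, those with
    y first and x last give the reversed order, and every order of three
    branches is one of the two up to rotation. *)
Lemma flexible_close (D D' : seq T -> Prop) x y b1 b2 b3 :
  (forall n w, D w -> D (rot n w)) -> (forall n w, D' w -> D' (rot n w)) ->
  (forall w, D [:: x, y & w] -> D' w) -> (forall w, D [:: y, x & w] -> D' w) ->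
  flexible D (Node (Leaf x) (comb [:: b1; b2; b3] y)) ->
  flexible D' (Node b1 (Node b2 b3)).
Proof.
move=> rD rD' c1 c2 f w [w1 [w23 [f1 [w2 [w3 [f2 f3 h']]] h]]].
have r3 : front (comb [:: b3] y) (w3 ++ [:: y]) by exact: front_left.
have l3 : front (comb [:: b3] y) ([:: y] ++ w3) by exact: front_right.
have K1 : D' (w1 ++ w2 ++ w3).
  apply: c2.
  have -> : [:: y, x & w1 ++ w2 ++ w3] =
      rot (size (x :: w1 ++ w2 ++ w3)) ((x :: w1 ++ w2 ++ w3) ++ [:: y]).
    by rewrite rot_size_cat.
  rewrite (_ : _ ++ [:: y] = [:: x] ++ (w1 ++ (w2 ++ (w3 ++ [:: y])))); last by rewrite /= -!catA.
  by apply/rD/f; do 3!apply: front_left => //.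
have K2 : D' (w3 ++ w2 ++ w1).
  apply: c1.
  have -> : [:: x, y & w3 ++ w2 ++ w1] =
      rot (size (y :: w3 ++ w2 ++ w1)) ((y :: w3 ++ w2 ++ w1) ++ [:: x]).
    by rewrite rot_size_cat.
  rewrite (_ : _ ++ [:: x] = ((([:: y] ++ w3) ++ w2) ++ w1) ++ [:: x]); last by rewrite /= -!catA.
  by apply/rD/f; do 3!apply: front_right => //.
case: h' h => -> [] ->.
- by [].
- by have := rD' (size w1) _ K1; rewrite rot_size_cat.
- by have := rD' (size (w3 ++ w2)) _ K2; rewrite catA rot_size_cat.
- by rewrite -catA.
Qed.

End Trees.

(** * Degrees and legal pairs *)

Section Degrees.
Variable V : finType.
Implicit Types (G : {set {set V}}) (S e : {set V}) (s : seq V) (x y u v : V).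

Lemma movesP G e : reflect
  (exists u v, [/\ u != v, e = [set u; v], e \notin G, degree G u < 3 & degree G v < 3])
  (e \in moves 3 G).
Proof.
rewrite inE; apply: (iffP and3P) => [[/cards2P [u [v [uv ->]]] eG /forall_inP d]|].
  by exists u, v; split=> //; apply: d; rewrite !inE eqxx ?orbT.
move=> [u [v [uv -> eG du dv]]]; split=> //; first by rewrite cards2 uv.
by apply/forall_inP => x; rewrite !inE => /orP[]/eqP ->.
Qed.

Lemma degree_add G e v : e \notin G -> degree (e |: G) v = (v \in e) + degree G v.
Proof.
move=> eG; rewrite /degree; have [ve|ve] := boolP (v \in e).
  have -> : [set f in e |: G | v \in f] = e |: [set f in G | v \in f].
    by apply/setP => f; rewrite !inE; case: eqP => // ->; rewrite ve.
  by rewrite cardsU1 inE (negPf eG).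
congr #|pred_of_set _|; apply/setP => f; rewrite !inE.
by case: eqP => // ->; rewrite (negPf ve) (negPf eG).
Qed.

Lemma degree_ge G x s : uniq s -> (forall y, y \in s -> y != x /\ [set x; y] \in G) ->
  size s <= degree G x.
Proof.
move=> us sG; have inj : {in s &, injective (fun y => [set x; y])}.
  move=> y z ys zs /setP /(_ y); rewrite !inE eqxx orbT.
  by have [/negPf -> _] := sG y ys; move/esym/eqP.
have <- : size [seq [set x; y] | y <- s] = size s by rewrite size_map.
rewrite /degree cardE; apply: uniq_leq_size; first by rewrite map_inj_in_uniq.
move=> e /mapP [y ys ->]; rewrite mem_enum !inE eqxx /= andbT.
by have [] := sG y ys.
Qed.

(** The word s lists the slots of S.  The last two clauses say that a class of
    at least two vertices has no isolated vertex, and that a class of at least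
    three vertices has no connected piece of two vertices; this is all that the
    legality of moves requires, so connectedness itself is not recorded. *)
Record slotted G S s : Prop := Slotted {
  sl_count : forall v, count_mem v s = if v \in S then 3 - degree G v else 0;
  sl_deg : 1 < #|S| -> forall v, v \in S -> 0 < degree G v;
  sl_pair : 2 < #|S| -> forall x y, x \in S -> y \in S -> x != y ->
    [set x; y] \in G -> degree G x = 1 -> degree G y = 1 -> False }.

Lemma slotted_perm G S s s' : perm_eq s s' -> slotted G S s -> slotted G S s'.
Proof. by move=> /permP p [c d e]; split=> // v; rewrite -p. Qed.

Lemma slotted_mem G S s v : slotted G S s -> v \in s ->
  v \in S /\ degree G v + count_mem v s = 3.
Proof.
move=> sl vs; have := sl_count sl v; have : 0 < count_mem v s by rewrite -has_count has_pred1.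
by case: (v \in S) => h c; split=> //; lia.
Qed.

Lemma slotted_free G S s v : slotted G S s -> v \in S -> degree G v < 3 -> v \in s.
Proof. by move=> sl vS d; rewrite -has_pred1 has_count (sl_count sl) vS; lia. Qed.

Lemma slotted_big G S s : slotted G S s -> 5 <= size s -> 2 < #|S|.
Proof.
move=> sl s5; rewrite ltnNge; apply/negP => S2.
have sS v : v \in s -> v \in S by case/(slotted_mem sl).
have two a b : (forall v, v \in S -> v = a \/ v = b) -> size s <= count_mem a s + count_mem b s.
  move=> Sab; rewrite -[X in _ <= X]count_predUI; apply: leq_trans (leq_addr _ _).
  rewrite -(count_predT s) [X in X <= _](@eq_in_count _ _ (predU (pred1 a) (pred1 b))) //.
  by move=> v /sS /Sab [] -> /=; rewrite eqxx ?orbT.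
have [S1|S1] := leqP #|S| 1.
  case: (pickP (mem s)) => [x xs|s0]; last first.
    by case: (s) s0 s5 => // x s' /(_ x) /=; rewrite inE eqxx.
  have [xS c] := slotted_mem sl xs.
  have Sx v : v \in S -> v = x by move=> vS; exact: (card_le1_eqP S1).
  have : size s <= count_mem x s; last by lia.
  rewrite -(count_predT s) [X in X <= _](@eq_in_count _ _ (pred1 x)) //.
  by move=> v /sS /Sx -> /=; rewrite eqxx.
have /cards2P [a [b [ab Sab]]] : #|S| == 2 by lia.
have := sl_count sl a; have := sl_count sl b.
have := sl_deg sl S1 (v := a); have := sl_deg sl S1 (v := b).
rewrite Sab !inE !eqxx orbT /= => /(_ isT) db /(_ isT) da cb ca.
have : size s <= count_mem a s + count_mem b s; last by rewrite ca cb; lia.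
by apply: two => v; rewrite Sab !inE => /orP[]/eqP; [left|right].
Qed.

Lemma addn_eq1 m n : m + n = 1 -> 0 < n -> n = 1.
Proof. by case: n => [|[|n]] //; rewrite !addnS. Qed.

Lemma slotted_close G S s s' u v : slotted G S s -> perm_eq s [:: u, v & s'] ->
  [set u; v] \in moves 3 G -> slotted ([set u; v] |: G) S s'.
Proof.
move=> sl p; rewrite inE cards2 => /and3P[uv eG _]; have {}uv : u != v by case: (u != v) uv.
have dE x : degree ([set u; v] |: G) x = (x \in [set u; v]) + degree G x by exact: degree_add.
have us : u \in s by rewrite (perm_mem p) mem_head.
have vs : v \in s by rewrite (perm_mem p) !in_cons eqxx orbT.
have [uS _] := slotted_mem sl us; have [vS _] := slotted_mem sl vs.
split.
- move=> x; have := sl_count sl x; move/permP: p => ->; rewrite /= dE !inE.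
  have [->|xu] := eqVneq x u; first by rewrite uS 1?eq_sym (negPf uv); lia.
  have [->|xv] := eqVneq x v; first by rewrite vS; lia.
  by [].  
- by move=> S1 x xS; rewrite dE addn_gt0 (sl_deg sl S1 xS) orbT.
- move=> S2 x y xS yS xy; rewrite !inE !dE.
  have dx := sl_deg sl (ltnW S2) xS; have dy := sl_deg sl (ltnW S2) yS.
  move=> /orP[/eqP E|xyG] h1 h2.
    have xE : x \in [set u; v] by rewrite -E !inE eqxx.
    by move: h1 dx; rewrite xE add1n => -[->].
  by apply: (sl_pair sl S2 xS yS xy xyG); [exact: addn_eq1 h1 dx|exact: addn_eq1 h2 dy].
Qed.

(** The two obstructions to joining a slot at x and a slot at y. *)
Definition bad G x y := (x == y) || ([set x; y] \in G).

Lemma badC G x y : bad G x y = bad G y x.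
Proof. by rewrite /bad eq_sym finset.setUC. Qed.

Lemma not_bad_move G S s x y : slotted G S s -> x \in s -> y \in s -> ~~ bad G x y ->
  [set x; y] \in moves 3 G /\ x != y.
Proof.
move=> sl xs ys; have [xS cx] := slotted_mem sl xs; have [yS cy] := slotted_mem sl ys.
rewrite negb_or => /andP[xy xyG]; split=> //; apply/movesP; exists x, y.
have : 0 < count_mem x s by rewrite -has_count has_pred1.
have : 0 < count_mem y s by rewrite -has_count has_pred1.
by move=> ? ?; split=> //; lia.
Qed.

(** Two slots at x mean degree 1, so at most one neighbour: z and t coincide,
    then z has two slots and degree 1 as well, and x and z form a piece of two
    vertices. *)
Lemma no_twin_clique G S s s' x z t : slotted G S s -> 2 < #|S| ->
  perm_eq s [:: x, x, z, t & s'] -> bad G x z -> bad G x t -> bad G z t -> False.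
Proof.
move=> sl S2 p bz bt bzt.
have S1 := ltnW S2.
have m v : v \in [:: x; x; z; t] -> v \in s.
  by move=> vq; rewrite (perm_mem p) (mem_cat v [:: x; x; z; t] s') vq.
have [xS dx] := slotted_mem sl (m x ltac:(by rewrite mem_head)).
have [zS dz] := slotted_mem sl (m z ltac:(by rewrite !in_cons eqxx !orbT)).
have [tS dt] := slotted_mem sl (m t ltac:(by rewrite !in_cons eqxx !orbT)).
have gx := sl_deg sl S1 xS; have gz := sl_deg sl S1 zS; have gt := sl_deg sl S1 tS.
have px : 2 + ((z == x) + (t == x)) <= count_mem x s.
  by rewrite (permP p) /= eqxx !addnA leq_addr.
have pz : 1 + (t == z) <= count_mem z s.
  rewrite (permP p) /= eqxx; do 2!apply: leq_trans (leq_addl _ _).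
  by rewrite addnA leq_addr.
have cx : count_mem x s <= 2 by rewrite -ltnS -dx -(addn1 (count_mem x s)) addnC leq_add2r.
have zx : z != x.
  by apply/eqP => E; rewrite E eqxx in px; have := leq_trans px cx.
have tx : t != x.
  by apply/eqP => E; rewrite E eqxx in px; case: (z == x) px => px; have := leq_trans px cx.
have d2 v : v \in S -> degree G v + count_mem v s = 3 -> 1 < count_mem v s -> degree G v = 1.
  move=> vS; have := sl_deg sl S1 vS; move: (degree G v) (count_mem v s) => k l; clear; lia.
have dx1 : degree G x = 1 by apply: d2 => //; apply: leq_trans px; rewrite leq_addr.
have xz : [set x; z] \in G by move: bz; rewrite /bad eq_sym (negPf zx).
have xt : [set x; t] \in G by move: bt; rewrite /bad eq_sym (negPf tx).
have [E|zt] := eqVneq z t; last first.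
  have := @degree_ge G x [:: z; t]; rewrite /= inE zt => /(_ isT) h.
  suff: 2 <= degree G x by rewrite dx1.
  by apply: h => y; rewrite !inE => /orP[]/eqP ->.
rewrite E eqxx -E in pz.
by apply: (sl_pair sl S2 xS zS _ xz) => //; [rewrite eq_sym|exact: d2].
Qed.

(** Four distinct, pairwise adjacent vertices have degree 3, hence no slot; the
    other cases are in [no_twin_clique]. *)
Lemma no_clique4 G S s s' a b c d : slotted G S s -> 2 < #|S| ->
  perm_eq s [:: a, b, c, d & s'] -> 
  ~~ [&& bad G a b, bad G a c, bad G a d, bad G b c, bad G b d & bad G c d].
Proof.
move=> sl S2 p; apply/negP => /and5P[ab ac ad bc /andP[bd cd]].
have P q : perm_eq [:: a; b; c; d] q -> perm_eq s (q ++ s').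
  by move=> h; apply: perm_trans p _; rewrite (perm_cat2r s' [:: a; b; c; d]).
have twin := no_twin_clique sl S2 (P [:: _; _; _; _] _).
(* Counting reduces permutations of concrete words to linear arithmetic. *)
have pm x y z t : (forall P, P a + (P b + (P c + (P d + 0))) = P x + (P y + (P z + (P t + 0))) :> nat) ->
    perm_eq [:: a; b; c; d] [:: x; y; z; t].
  by move=> h; apply/permP => Q; exact: h (fun v => Q v : nat).
have [E|nab] := eqVneq a b.
  by apply: (twin a c d) => //; apply: pm => Q; rewrite E; clear; lia.
have [E|nac] := eqVneq a c.
  by apply: (twin a b d) => //; apply: pm => Q; rewrite E; clear; lia.
have [E|nad] := eqVneq a d.
  by apply: (twin a b c) => //; apply: pm => Q; rewrite E; clear; lia.
have [E|nbc] := eqVneq b c.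
  by apply: (twin b a d) => //; rewrite 1?badC //; apply: pm => Q; rewrite E; clear; lia.
have [E|nbd] := eqVneq b d.
  by apply: (twin b a c) => //; rewrite 1?badC //; apply: pm => Q; rewrite E; clear; lia.
have [E|ncd] := eqVneq c d.
  by apply: (twin c a b) => //; rewrite 1?badC //; apply: pm => Q; rewrite E; clear; lia.
have as' : a \in s by rewrite (perm_mem p) mem_head.
have [aS da] := slotted_mem sl as'.
have ca : 0 < count_mem a s by rewrite -has_count has_pred1.
suff : 3 <= degree G a.
  by move: da ca; move: (degree G a) (count_mem a s) => k l; clear; lia.
apply: (@degree_ge G a [:: b; c; d]); first by rewrite /= !inE negb_or nbc nbd ncd.
move: ab ac ad; rewrite /bad (negPf nab) (negPf nac) (negPf nad) /= => ab ac ad.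
by move=> y; rewrite !inE => /or3P[]/eqP ->; rewrite eq_sym.
Qed.

End Degrees.

(** * Components with a flexible drawing *)

Section Components.
Variables (R : realType) (V : finType).
Implicit Types (G : {set {set V}}) (S e : {set V}) (s w : seq V) (x y u v : V).

Lemma drawn_rotn S G w n : drawn R S G w -> drawn R S G (rot n w).
Proof.
move=> d; elim: n => [|n IH]; first by rewrite rot0.
have [nw|wn] := ltnP n (size w); last by rewrite rot_oversize // leqW.
rewrite -[n.+1]add1n rotD //; case: (rot n w) IH => [|x s] //.
by rewrite rot1_cons; exact: drawn_rot.
Qed.

Definition component G S (t : tree V) : Prop :=
  slotted G S (leaves t) /\ flexible (drawn R S G) t.

Lemma component_other G S t e : component G S t -> e \notin G ->
  (forall v, v \in e -> v \notin S) -> e != finset.set0 -> component (e |: G) S t.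
Proof.
move=> [[c d p] f] eG eS e0.
have dE v : v \in S -> degree (e |: G) v = degree G v.
  move=> vS; rewrite degree_add //; have [/eS|//] := boolP (v \in e).
  by rewrite vS.
split; first split.
- by move=> v; rewrite c; case: ifP => // vS; rewrite dE.
- by move=> S1 v vS; rewrite dE //; exact: d.
- move=> S2 x y xS yS xy; rewrite !dE // !inE => /orP[/eqP E|]; last exact: p.
  by have := eS x; rewrite -E !inE eqxx xS => /(_ isT).
move=> w /f dw; apply: drawn_sub dw _ => g; rewrite !inE => /orP[/eqP ->|//] sub.
have [v ve] := set0Pn _ e0.
by have := eS v ve; rewrite (fintype.subsetP sub).
Qed.

Lemma component_close G S t u v : component G S t -> closable u v t ->
  [set u; v] \in moves 3 G ->
  exists2 t', component ([set u; v] |: G) S t' & size (leaves t) = (size (leaves t')).+2.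
Proof.
move=> [sl f] [b1 [b2 [b3 h]]] mv.
have uv : u != v by move: mv; rewrite inE cards2 => /and3P[]; case: (u != v).
have p : perm_eq (leaves t) [:: u, v & leaves (Node b1 (Node b2 b3))].
  have [/permP p _] := h; apply/permP => P; rewrite p /= !count_cat /=; clear; lia.
exists (Node b1 (Node b2 b3)); last by rewrite (perm_size p).
split; first exact: slotted_close sl p mv.
apply: flexible_close (flexible_reroot _ h f).
- by move=> n w; exact: drawn_rotn.
- by move=> n w; exact: drawn_rotn.
- by move=> w dw; exact: drawn_cap uv dw.
- move=> w dw; rewrite (finset.setUC [set u]); apply: drawn_cap dw.
  by rewrite eq_sym.
- by move=> n w; exact: drawn_rotn.
Qed.

Lemma component_reduce G S t : component G S t -> 5 <= size (leaves t) <= 8 ->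
  exists f t', [/\ f \in moves 3 G, f \subset S, component (f |: G) S t'
    & size (leaves t) = (size (leaves t')).+2].
Proof.
move=> ct sz; have [sl fl] := ct; have [s5 _] := andP sz.
have S2 := slotted_big sl s5.
have [a [b [c [d [s [p [ab ac ad [bc bd cd]]]]]]]] := four_close_mid sz.
have nc := no_clique4 sl S2 p.
have m x : x \in [:: a; b; c; d] -> x \in leaves t.
  by move=> xq; rewrite (perm_mem p) (mem_cat x [:: a; b; c; d] s) xq.
have main x y : x \in [:: a; b; c; d] -> y \in [:: a; b; c; d] -> closable x y t ->
    ~~ bad G x y -> exists f t', [/\ f \in moves 3 G, f \subset S, component (f |: G) S t'
    & size (leaves t) = (size (leaves t')).+2].
  move=> /m xt /m yt cl nb.
  have [mv _] := not_bad_move sl xt yt nb.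
  have [t' ct' st'] := component_close ct cl mv.
  exists [set x; y], t'; split=> //.
  have [xS _] := slotted_mem sl xt; have [yS _] := slotted_mem sl yt.
  by apply/fintype.subsetP => z; rewrite !inE => /orP[]/eqP ->.
have [ia ib ic id] : [/\ a \in [:: a; b; c; d], b \in [:: a; b; c; d],
    c \in [:: a; b; c; d] & d \in [:: a; b; c; d]].
  by rewrite !in_cons !eqxx !orbT.
move: nc; rewrite !negb_and => /or4P[|||/or3P[]]; [exact: main ab|exact: main ac|
  exact: main ad|exact: main bc|exact: main bd|exact: main cd].
Qed.

(** The class becomes rigid after the move uv, but the reply can be read off from the
    drawings that existed before: draw the edge of the reply first, in the
    position where the path from u to v separates it from the other two slots,
    then draw uv. *)
Lemma component_cycle G S t u v a b c d : component G S t ->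
  reroot t (Node (Leaf u) (comb [:: Leaf a; Leaf b; Leaf c; Leaf d] v)) ->
  [set u; v] \in moves 3 G -> size (leaves t) = 6 ->
  exists f t', [/\ f \in moves 3 ([set u; v] |: G), f \subset S,
    component (f |: ([set u; v] |: G)) S t' & size (leaves t') = 2].
Proof.
move=> [sl fl] h mv sz.
have uv : u != v by move: mv; rewrite inE cards2 => /and3P[]; case: (u != v).
have p : perm_eq (leaves t) [:: u; v; a; b; c; d].
  have [/permP p _] := h; apply/permP => P; rewrite p /=; clear; lia.
have S2 : 2 < #|S| by apply: slotted_big sl _; rewrite sz.
have {}sl := slotted_close sl p mv.
have nc := no_clique4 sl S2 (perm_refl _).
have {}fl : flexible (drawn R S G) (Node (Leaf u) (comb [:: Leaf a; Leaf b; Leaf c; Leaf d] v)).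
  by apply: flexible_reroot h fl => n w; exact: drawn_rotn.
have [wab wac wad [wbc wbd wcd]] := flexible_cycle fl.
have main x y z k : perm_eq [:: a; b; c; d] [:: x; y; z; k] ->
    drawn R S G [:: u; z; k; v; y; x] -> ~~ bad ([set u; v] |: G) x y ->
  exists f t', [/\ f \in moves 3 ([set u; v] |: G), f \subset S,
    component (f |: ([set u; v] |: G)) S t' & size (leaves t') = 2].
  move=> q dr nb; have {}sl := slotted_perm q sl.
  have xq : x \in [:: x; y; z; k] by rewrite mem_head.
  have yq : y \in [:: x; y; z; k] by rewrite !in_cons eqxx orbT.
  have [mv' xy] := not_bad_move sl xq yq nb.
  exists [set x; y], (Node (Leaf z) (Leaf k)); split=> //.
    have [xS _] := slotted_mem sl xq; have [yS _] := slotted_mem sl yq.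
    by apply/fintype.subsetP => i; rewrite !inE => /orP[]/eqP ->.
  split; first exact: slotted_close sl (perm_refl _) mv'.
  have d1 : drawn R S ([set y; x] |: G) [:: u; z; k; v].
    by apply: drawn_cap (drawn_rotn 4 dr); rewrite eq_sym.
  have d2 : drawn R S ([set v; u] |: ([set y; x] |: G)) [:: z; k].
    by apply: drawn_cap (drawn_rotn 3 d1); rewrite eq_sym.
  have {}d2 : drawn R S ([set x; y] |: ([set u; v] |: G)) [:: z; k].
    by rewrite finset.setUCA (finset.setUC [set x]) (finset.setUC [set u]).
  by move=> w [_ [_ [-> -> [] ->]]] //; exact: (drawn_rotn 1 d2).
(* Counting reduces permutations of concrete words to linear arithmetic. *)
have pm x y z k : (forall P : V -> nat,
    P a + (P b + (P c + (P d + 0))) = P x + (P y + (P z + (P k + 0)))) ->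
    perm_eq [:: a; b; c; d] [:: x; y; z; k].
  by move=> hP; apply/permP => Q; exact: hP (fun v => Q v : nat).
move: nc; rewrite !negb_and => /or4P[|||/or3P[]].
- by apply: main wab; apply: pm => P; clear; lia.
- by apply: main wac; apply: pm => P; clear; lia.
- by apply: main wad; apply: pm => P; clear; lia.
- by apply: main wbc; apply: pm => P; clear; lia.
- by apply: main wbd; apply: pm => P; clear; lia.
- by apply: main wcd; apply: pm => P; clear; lia.
Qed.

Lemma component_join G S1 S2 t1 t2 u v : component G S1 t1 -> component G S2 t2 ->
  (forall x, x \in S1 -> x \in S2 -> False) ->
  (forall e, e \in G -> 1 < #|e| /\ forall x y, x \in e -> y \in e ->
    (x \in S1) = (y \in S1) /\ (x \in S2) = (y \in S2)) ->
  u \in S1 -> v \in S2 -> [set u; v] \in moves 3 G ->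
  exists2 t, component ([set u; v] |: G) (S1 :|: S2) t &
    (size (leaves t)).+2 = size (leaves t1) + size (leaves t2).
Proof.
move=> [sl1 f1] [sl2 f2] dS eS uS vS mv.
move: (mv); rewrite inE => /and3P[_ eG /forall_inP dG].
have dE x : degree ([set u; v] |: G) x = (x \in [set u; v]) + degree G x by exact: degree_add.
have ut : u \in leaves t1 by apply: slotted_free sl1 uS _; apply: dG; rewrite !inE eqxx.
have vt : v \in leaves t2 by apply: slotted_free sl2 vS _; apply: dG; rewrite !inE eqxx orbT.
have uS2 : u \in S2 = false by apply/negP => /(dS u uS).
have vS1 : v \in S1 = false by apply/negP => vS1; exact: dS v vS1 vS.
have uv : u != v by apply: contraTneq uS => ->; rewrite vS1.
have uv' : u == v = false by apply/negbTE.
have vu : v == u = false by rewrite eq_sym.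
have [t1' h1] := extract_leaf ut; have [t2' h2] := extract_leaf vt.
have [p1 _] := h1; have [p2 _] := h2.
exists (Node t1' t2'); last by rewrite (perm_size p1) (perm_size p2) /= size_cat addSn addnS.
split; last first.
  have rd S G' n w : drawn R S G' w -> drawn R S G' (rot n w) by exact: drawn_rotn.
  apply: flexible_join (flexible_reroot (rd _ _) h1 f1) (flexible_reroot (rd _ _) h2 f2).
    exact: rd.
  move=> w1 w2 d1 d2; have d : drawn R (S1 :|: S2) G (rcons w1 u ++ v :: w2).
    apply: drawn_cat d1 d2 dS _ => e eG' /fintype.subsetP sub.
    have [e1 exy] := eS e eG'; have /card_gt0P [x xe] := ltnW e1.
    have := sub x xe; rewrite inE => /orP[] xS; [left|right]; apply/fintype.subsetP => y ye;
      by have [E1 E2] := exy x y xe ye; rewrite -?E1 -?E2.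
  rewrite -cats1 -catA /= in d; have {}d := drawn_rotn (size w1) d.
  rewrite rot_size_cat /= in d; have {}d := drawn_cap uv d.
  by have := drawn_rotn (size w2) d; rewrite rot_size_cat.
split.
- move=> x; have := sl_count sl1 x; have := sl_count sl2 x.
  rewrite (permP p1) (permP p2) /= count_cat dE !inE.
  have [->|xu] := eqVneq x u.
    rewrite uS uS2 ?vu ?uv' /=.
    move: (count_mem _ _) (count_mem _ _) (degree _ _) => k l d; clear; lia.
  have [->|xv] := eqVneq x v.
    rewrite vS vS1 ?vu ?uv' /=.
    move: (count_mem _ _) (count_mem _ _) (degree _ _) => k l d; clear; lia.
  rewrite /= !add0n => c2 c1; rewrite {}c1 {}c2.
  have [x1|x1] := boolP (x \in S1); have [x2|x2] := boolP (x \in S2) => //=; last by rewrite addn0.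
  by case: (dS x x1 x2).
- move=> _ x; rewrite dE !inE.
  have [->|xu] := eqVneq x u; first by [].
  have [->|xv] := eqVneq x v; first by [].
  move=> /orP[] xS /=; [apply: (sl_deg sl1) => //|apply: (sl_deg sl2) => //];
    apply/card_gt1P.
    by exists x, u.
  by exists x, v.
move=> S3 x y; rewrite !dE => xS yS xy.
have only1 z : z \in S1 -> degree G z = 0 -> #|S1| <= 1.
  by move=> zS d0; rewrite leqNgt; apply/negP => /(sl_deg sl1)/(_ z zS); rewrite d0.
have only2 z : z \in S2 -> degree G z = 0 -> #|S2| <= 1.
  by move=> zS d0; rewrite leqNgt; apply/negP => /(sl_deg sl2)/(_ z zS); rewrite d0.
rewrite !inE; have [E _|nE /= xyG] := eqVneq [set x; y] [set u; v].
  have [xE yE] : x \in [set u; v] /\ y \in [set u; v].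
    by rewrite -E !inE !eqxx orbT.
  move=> h1' h2'; have dx : degree G x = 0 by move: xE h1'; rewrite !inE => ->; rewrite add1n => -[].
  have dy : degree G y = 0 by move: yE h2'; rewrite !inE => ->; rewrite add1n => -[].
  have [du dv] : degree G u = 0 /\ degree G v = 0.
    have [ux vx] : u \in [set x; y] /\ v \in [set x; y] by rewrite E !inE !eqxx orbT.
    by split; [move: ux|move: vx]; rewrite !inE => /orP[]/eqP ->.
  have := only1 u uS du; have := only2 v vS dv.
  have := (leq_card_setU S1 S2).1; move: S3; move: #|S1| #|S2| #|S1 :|: S2| => k l n; clear; lia.
have [_ exy] := eS _ xyG; have [||E1 E2] := exy x y; rewrite ?inE ?eqxx ?orbT //.
have gx : 0 < degree G x.
  by rewrite card_gt0; apply/set0Pn; exists [set x; y]; rewrite !inE xyG eqxx.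
have gy : 0 < degree G y.
  by rewrite card_gt0; apply/set0Pn; exists [set x; y]; rewrite !inE xyG eqxx orbT.
move=> h1' h2'.
have [xu xv yu yv] : [/\ x != u, x != v, y != u & y != v].
  have n1 z : 0 < degree G z -> ((z == u) || (z == v)) + degree G z = 1 -> z != u /\ z != v.
    by case: (degree G z) => // k _; case: eqVneq => //= _; case: eqVneq.
  by have [] := n1 x gx h1'; have [] := n1 y gy h2'.
rewrite (negPf xu) (negPf xv) (negPf yu) (negPf yv) /= !add0n in h1' h2'.
move: xS; rewrite inE => /orP[] xS.
  apply: (sl_pair sl1 _ xS _ xy xyG) => //; last by rewrite -E1.
  by apply/card_gt2P; exists x, y, u; rewrite -E1 xS uS xy yu eq_sym xu.
apply: (sl_pair sl2 _ xS _ xy xyG) => //; last by rewrite -E2.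
by apply/card_gt2P; exists x, y, v; rewrite -E2 xS vS xy yv eq_sym xv.
Qed.

End Components.

(** * Positions and the strategy *)

Section States.
Variables (R : realType) (V : finType).
Implicit Types (G : {set {set V}}) (S e f : {set V}) (u v x y i j k : V) (c : V -> V) (m : V -> nat).

Definition tame (b : nat) G S := exists2 t, component R G S t & size (leaves t) <= b.

Definition cls c i : {set V} := [set v | c v == i].

(** The classes are the fibres of a colouring c of the vertices, and m bounds
    their numbers of slots.  A colouring makes it easy to merge two classes;
    empty classes are harmless. *)
Record state c m G : Prop := State {
  st_edge : forall e, e \in G -> #|e| = 2;
  st_mono : forall e x y, e \in G -> x \in e -> y \in e -> c x = c y;
  st_tame : forall i, tame (m i) G (cls c i) }.

Definition upd m i (b : nat) j := if j == i then b else m j.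

Lemma state_le c m m' G : (forall i, m i <= m' i) -> state c m G -> state c m' G.
Proof.
move=> mm' [e2 mono tm]; split=> // i.
by have [t ct st] := tm i; exists t => //; exact: leq_trans (mm' i).
Qed.

(** A state in which nothing is asked of the class j, for use between a move
    that makes this class rigid and the reply to it. *)
Definition state_off c m j G : Prop :=
  [/\ forall e, e \in G -> #|e| = 2,
      forall e x y, e \in G -> x \in e -> y \in e -> c x = c y
    & forall i, i != j -> tame (m i) G (cls c i)].

Lemma state_offW c m j G : state c m G -> state_off c m j G.
Proof. by move=> [? ? ?]; split. Qed.

Lemma state_on c m j G b : state_off c m j G -> tame b G (cls c j) ->
  state c (upd m j b) G.
Proof.
by move=> [e2 mono tm] tj; split=> // i; rewrite /upd; case: eqVneq => [->|/tm].
Qed.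

Lemma state_off_move c m j G e : state_off c m j G -> e \in moves 3 G ->
  e \subset cls c j -> state_off c m j (e |: G).
Proof.
move=> [e2 mono tm] /movesP [u [v [uv eE eG _ _]]] /fintype.subsetP eC.
have ec x : x \in e -> c x = j by move=> /eC; rewrite inE => /eqP.
split.
- move=> f; rewrite !inE => /orP[/eqP ->|/e2 //].
  by rewrite eE cards2 uv.
- move=> f x y; rewrite !inE => /orP[/eqP ->|fG]; last exact: mono.
  by move=> /ec -> /ec ->.
- move=> i ij; have [t ct st] := tm i ij; exists t => //; apply: component_other => //.
    by move=> x /ec cx; rewrite inE cx eq_sym.
  by apply/set0Pn; exists u; rewrite eE !inE eqxx.
Qed.

Lemma state_close c m G e j b : state c m G -> e \in moves 3 G ->
  e \subset cls c j -> tame b (e |: G) (cls c j) -> state c (upd m j b) (e |: G).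
Proof. by move=> /(state_offW j) st me ej; apply: state_on; exact: state_off_move. Qed.

Lemma tame_empty c m G : state c m G -> tame 0 G finset.set0.
Proof.
move=> [e2 _ _]; exists (Bare V) => //; split; first split.
- by move=> v; rewrite finset.in_set0.
- by rewrite cards0.
- by rewrite cards0.
- move=> w ->; apply: drawn0 => e /e2 e2'.
  by rewrite -card_gt0 e2'.
Qed.

(** The class of u is recoloured with the colour of v, so the colour of u is left
    with an empty class. *)
Lemma state_join c m G u v : state c m G -> [set u; v] \in moves 3 G -> c u <> c v ->
  exists c', state c' (fun k => if k == c v then (m (c u) + m (c v)).-2
                       else if k == c u then 0 else m k) ([set u; v] |: G).
Proof.
move=> st mv cuv; have t0 := tame_empty st; have [e2 mono tm] := st.
pose c' x := if c x == c u then c v else c x; exists c'.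
have eG : [set u; v] \notin G by move: mv; rewrite inE => /and3P[].
have other S t : component R G S t -> u \notin S -> v \notin S ->
    component R ([set u; v] |: G) S t.
  move=> ct uS vS; apply: component_other => //.
    by move=> x; rewrite !inE => /orP[]/eqP ->.
  by apply/set0Pn; exists u; rewrite !inE eqxx.
split.
- move=> f; rewrite !inE => /orP[/eqP ->|/e2 //].
  by move: mv; rewrite inE => /andP[/eqP].
- move=> f x y; rewrite !inE => /orP[/eqP ->|fG xf yf]; last by rewrite /c' (mono f x y).
  have E z : z \in [set u; v] -> c' z = c v.
    by rewrite !inE /c' => /orP[]/eqP ->; rewrite ?eqxx //; case: ifP.
  by move=> xe ye; exact: etrans (E x xe) (esym (E y ye)).
move=> k; have [->|kv] := eqVneq k (c v).
  have -> : cls c' (c v) = cls c (c u) :|: cls c (c v).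
    by apply/setP => x; rewrite !inE /c'; case: ifP => //; rewrite eqxx.
  have [t1 c1 s1] := tm (c u); have [t2 c2 s2] := tm (c v).
  have [||||t ct ts] := component_join c1 c2 _ _ _ _ mv.
  - by move=> x; rewrite !inE => /eqP -> /eqP.
  - move=> e eG'; split; first by rewrite e2.
    by move=> x y xe ye; rewrite !inE (mono e x y).
  - by rewrite inE.
  - by rewrite inE.
  exists t => //; move: s1 s2 ts; move: (size _) (size _) (size _) (m _) (m _).
  clear; lia.
have [->|ku] := eqVneq k (c u).
  have -> : cls c' (c u) = finset.set0.
    apply/setP => x; rewrite !inE /c'; case: ifP => // _.
    by apply/eqP => h; apply: cuv.
  have [t ct ts] := t0; exists t => //; apply: other => //; by rewrite finset.in_set0.
have -> : cls c' k = cls c k.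
  apply/setP => x; rewrite !inE /c'; case: (c x =P c u) => [->|//].
  by rewrite ![c _ == k]eq_sym (negPf kv) (negPf ku).
have [t ct ts] := tm k; exists t => //; apply: other => //; by rewrite inE eq_sym.
Qed.

Lemma state_reduce c m G j b : state c m G -> 4 <= b <= 6 -> m j <= b.+2 ->
  state c (upd m j b) G \/
  exists2 f, f \in moves 3 G & state c (upd m j b) (f |: G).
Proof.
move=> st b46 mj; have [e2 mono tm] := st; have [t ct ts] := tm j.
have [sb|sb] := leqP (size (leaves t)) b.
  left; split=> // i; rewrite /upd; case: eqP => [->|_]; last exact: tm.
  by exists t.
have [|f [t' [mf fS ct' st']]] := component_reduce ct.
  move: sb ts mj b46; move: (size _) (m _) => p q; clear; lia.
right; exists f => //; apply: state_close => //; exists t' => //.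
move: st' ts mj; move: (size _) (size _) (m _) => p q r; clear; lia.
Qed.

Lemma state_planar c m G : state c m G -> planar R G.
Proof.
move=> [e2 mono tm].
have U (s : seq V) : uniq s -> exists w, drawn R [set x | c x \in s] G w.
  elim: s => [_|i s IH /= /andP[is' us]].
    exists [::]; have -> : [set x | c x \in [::]] = finset.set0 :> {set V}.
      by apply/setP => x; rewrite !inE.
    by apply: drawn0 => e /e2 e2'; rewrite -card_gt0 e2'.
  have [w dw] := IH us; have [t [_ ft] _] := tm i.
  exists (leaves t ++ w).
  have -> : [set x | c x \in i :: s] = cls c i :|: [set x | c x \in s].
    by apply/setP => x; rewrite !inE.
  apply: drawn_cat (ft _ (front_leaves t)) dw _ _.
    by move=> x; rewrite !inE => /eqP ->; rewrite (negPf is').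
  move=> e eG /fintype.subsetP sub.
  have /card_gt0P [x xe] : 0 < #|e| by rewrite e2.
  have := sub x xe; rewrite !inE => /orP[/eqP xi|xs]; [left|right];
    by apply/fintype.subsetP => y ye; rewrite inE (mono e y x) ?xi.
have [w dw] := U (enum V) (enum_uniq V).
apply: (@drawn_planar _ _ _ w) => [e /e2 -> //|].
by rewrite (_ : [set: V] = [set x | c x \in enum V]) //; apply/setP => x; rewrite !inE mem_enum.
Qed.

(** The bounds on the numbers of slots, for the exceptional class r if any. *)
Definition cap (r : option V) k := if r == Some k then 6 else 4.

Definition safe G := exists c r, state c (cap r) G.

Definition savable G := (moves 3 G = finset.set0 /\ planar R G) \/
  exists2 f, f \in moves 3 G & safe (f |: G).

Lemma cap_ge r k : 4 <= cap r k.
Proof. by rewrite /cap; case: ifP. Qed.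

Lemma cap_le r k : cap r k <= 6.
Proof. by rewrite /cap; case: ifP. Qed.

Lemma cap_pair r i j : i != j -> cap r i + cap r j <= 10.
Proof. by rewrite /cap => ij; case: eqP => [->|_]; case: eqP => // -[] /eqP; rewrite (negPf ij). Qed.

Lemma upd_cap r j b : b <= 4 -> forall k, upd (cap r) j b k <= cap (if r == Some j then None else r) k.
Proof.
move=> b4 k; rewrite /upd; case: eqP => [->|kj]; first exact: leq_trans (cap_ge _ _).
by case: eqP => // ->; rewrite /cap; case: eqP => // -[] /esym.
Qed.

Lemma tame_close G S u v b : tame b G S -> b <= 5 -> u \in S -> v \in S ->
  [set u; v] \in moves 3 G -> tame (b - 2) ([set u; v] |: G) S.
Proof.
move=> [t ct ts] b5 uS vS mv; have [sl _] := ct.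
move: (mv); rewrite inE cards2 => /and3P[uv _ /forall_inP d].
have {}uv : u != v by case: (u != v) uv.
have ut : u \in leaves t by apply: slotted_free sl uS _; apply: d; rewrite !inE eqxx.
have vt : v \in leaves t by apply: slotted_free sl vS _; apply: d; rewrite !inE eqxx orbT.
have cl := closable_small uv ut vt (leq_trans ts b5).
have [t' ct' st'] := component_close ct cl mv; exists t' => //.
by move: ts; rewrite st'; case: (b) => [|[|n]] //; rewrite !ltnS !subSS subn0.
Qed.

Lemma free_move G : safe G -> savable G.
Proof.
move=> [c [r st]].
wlog oN : r st / r = None.
  case: r st => [j|] st W; last exact: (W None).
  have cj : cap (Some j) j <= 6 by exact: cap_le.
  case: (state_reduce st (_ : 4 <= 4 <= 6) cj) => // [|[f mf]] st'.
    apply: (W None) => //; apply: state_le st' => k.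
    by have := upd_cap (Some j) j (leqnn 4) k; rewrite eqxx.
  right; exists f => //; exists c, None; apply: state_le st' => k.
  by have := upd_cap (Some j) j (leqnn 4) k; rewrite eqxx.
subst r.
have [M0|[e me]] := set_0Vmem (moves 3 G); first by left; split=> //; exact: state_planar st.
right; exists e => //; have /movesP [u [v [uv eE eG du dv]]] := me.
rewrite eE in me *.
have [cuv|cuv] := eqVneq (c u) (c v).
  have [_ _ /(_ (c v)) tm] := st.
  exists c, None; apply: (@state_le c (upd (cap None) (c v) 4)).
    by move=> k; exact: (upd_cap None (c v) (leqnn 4) k).
  apply: (state_close st me).
    by apply/fintype.subsetP => x; rewrite !inE => /orP[]/eqP ->; rewrite ?cuv.
  have [|||t ct ts] := tame_close tm _ _ _ me; rewrite ?inE ?cuv //.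
  by exists t => //; exact: leq_trans ts _.
have [c' st'] := state_join st me (elimN eqP cuv).
exists c', (Some (c v)); apply: state_le st' => k.
have [->|kv] := eqVneq k (c v); first by rewrite /cap eqxx.
by case: ifP => // _; exact: cap_ge.
Qed.

Lemma answer G e : safe G -> e \in moves 3 G -> savable (e |: G).
Proof.
move=> [c [r st]] me; have /movesP [u [v [uv eE eG du dv]]] := me.
rewrite {}eE in eG me *.
have [cuv|cuv] := eqVneq (c u) (c v).
  have sub : [set u; v] \subset cls c (c v).
    by apply/fintype.subsetP => x; rewrite !inE => /orP[]/eqP ->; rewrite ?cuv.
  have [_ _ /(_ (c v)) [t ct ts]] := st; have [sl _] := ct.
  have t6 := leq_trans ts (cap_le _ _).
  have ut : u \in leaves t by apply: slotted_free sl _ du; rewrite inE cuv.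
  have vt : v \in leaves t by apply: slotted_free sl _ dv; rewrite inE.
  have [cl|[x [y [z [k [h s6]]]]]] := closable_or_cycle uv ut vt t6.
    have [t' ct' st'] := component_close ct cl me.
    have tj : tame 4 ([set u; v] |: G) (cls c (c v)).
      by exists t' => //; move: t6; rewrite st'.
    apply: free_move; exists c, (if r == Some (c v) then None else r).
    by apply: state_le (upd_cap _ _ (leqnn 4)) _; exact: state_close st me sub tj.
  have [f [t' [mf fS ct' st']]] := component_cycle ct h me s6.
  right; exists f => //; exists c, (if r == Some (c v) then None else r).
  apply: state_le (upd_cap _ _ (leqnn 4)) _; apply: state_on; last first.
    by exists t' => //; rewrite st'.
  apply: state_off_move mf fS; apply: state_off_move me sub.
  exact: state_offW st.
have [c' st'] := state_join st me (elimN eqP cuv).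
case: r st st' => [j|] st st'; last first.
  apply: free_move; exists c', (Some (c v)); apply: state_le st' => k.
  have [->|kv] := eqVneq k (c v); first by rewrite /cap eqxx.
  by case: ifP => // _; exact: cap_ge.
(* Either the exceptional class takes part in the merger, which has then at most
   6 + 4 - 2 slots, or the merger may become a second exceptional class. *)
have [jE|jN] := boolP ((j == c u) || (j == c v)).
  have fin G' : state c' (upd (fun k => if k == c v then 8 else 4) (c v) 6) G' -> safe G'.
    move=> st''; exists c', (Some (c v)); apply: state_le st'' => k.
    rewrite /upd; have [->|kv] := eqVneq k (c v); first by rewrite /cap eqxx.
    exact: cap_ge.
  have {}st' : state c' (fun k => if k == c v then 8 else 4) ([set u; v] |: G).
    apply: state_le st' => k; have [_|kv] := eqVneq k (c v).
      by have := cap_pair (Some j) cuv; case: (_ + _) => [|[|p]].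
    case: (eqVneq k (c u)) => // ku; rewrite /cap.
    by case: (Some j =P Some k) => // -[E]; move: jE; rewrite E (negPf ku) (negPf kv).
  case: (state_reduce (b := 6) (j := c v) st') => //=; first by rewrite eqxx.
    by move=> /fin /free_move.
  by move=> [f mf /fin sf]; right; exists f.
have fin G' : state c' (upd (fun k => if k == c v then 6 else cap (Some j) k) (c v) 4) G' -> safe G'.
  move=> st''; exists c', (Some j); apply: state_le st'' => k.
  rewrite /upd; have [->|kv] := eqVneq k (c v); last by [].
  exact: cap_ge.
have {}st' : state c' (fun k => if k == c v then 6 else cap (Some j) k) ([set u; v] |: G).
  apply: state_le st' => k; have [_|kv] := eqVneq k (c v).
    have cap4 i : j != i -> cap (Some j) i = 4.
      by move=> ji; rewrite /cap; case: (Some j =P Some i) => // -[E]; rewrite E eqxx in ji.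
    by move: jN; rewrite negb_or => /andP[/cap4 -> /cap4 ->].
  by case: ifP.
case: (state_reduce (b := 4) (j := c v) st') => //=; first by rewrite eqxx.
  by move=> /fin /free_move.
by move=> [f mf /fin sf]; right; exists f.
Qed.

Lemma safe0 : safe finset.set0.
Proof.
exists id, None; split.
- by move=> e; rewrite finset.in_set0.
- by move=> e x y; rewrite finset.in_set0.
- move=> i; have -> : cls id i = [set i] by apply/setP => x; rewrite !inE.
  exists (Node (Leaf i) (Node (Leaf i) (Leaf i))) => //; split; first split.
  + move=> x; rewrite /= inE eq_sym; have -> : degree finset.set0 x = 0.
      by apply/eqP; rewrite cards_eq0; apply/eqP/setP => e; rewrite !inE.
    by case: eqP.
  + by rewrite cards1.
  + by rewrite cards1.
  + move=> w fw; have -> : w = [:: i; i; i].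
      by move: fw => [_ [_ [-> [_ [_ [-> -> [] ->]]] [] ->]]].
    by apply: drawn1 => e; rewrite finset.in_set0.
Qed.

Lemma safe_planar G : safe G -> planar R G.
Proof. by move=> [c [r st]]; exact: state_planar st. Qed.

End States.

Section Strategy.
Variables (R : realType) (V : finType).
Implicit Types (s : seq {set V}) (G : {set {set V}}).

Definition saving s : {set V} :=
  if [pick f in moves 3 (position s) | `[< safe R (f |: position s) >]] is Some f then f
  else odflt finset.set0 [pick f in moves 3 (position s)].

Lemma saving_move s : ~ game_over 3 s -> saving s \in moves 3 (position s).
Proof.
move=> go; rewrite /saving; case: pickP => [f /andP[] //|_].
case: pickP => [f //|M0]; case: go; apply/setP => f.
by rewrite finset.in_set0; exact: M0.
Qed.

Lemma saving_safe s f : f \in moves 3 (position s) -> safe R (f |: position s) ->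
  safe R (saving s |: position s).
Proof.
move=> mf sf; rewrite /saving; case: pickP => [g /andP[_ /asboolP] //|/(_ f)].
by rewrite mf => /negbT/negP; case; apply/asboolP.
Qed.

Lemma position_take s i : i < size s ->
  position (take i.+1 s) = nth finset.set0 s i |: position (take i s).
Proof.
move=> h; rewrite (take_nth finset.set0) //; apply/setP => e.
by rewrite !inE mem_rcons inE.
Qed.

Lemma saving_invariant first player s i : legal_play 3 s ->
  follows first player saving s -> i <= size s ->
  if to_move first (take i s) == player then savable R (position (take i s))
  else safe R (position (take i s)).
Proof.
move=> ls fs; elim: i => [_|i IH iw].
  have -> : position (take 0 s) = finset.set0 :> {set {set V}}.
    by rewrite take0; apply/setP => e; rewrite !inE.
  have s0 := safe0 R V; case: ifP => // _; exact: free_move.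
have {IH} := IH (ltnW iw); rewrite position_take //.
have mv := ls i iw.
have alt : to_move first (take i.+1 s) = ~~ to_move first (take i s).
  by rewrite /to_move !size_takel ?(ltnW iw) //= addbN.
have [tm|tm] := eqVneq (to_move first (take i s)) player.
  rewrite alt tm; have -> : (~~ player == player) = false by case: (player).
  rewrite (fs i iw tm) => -[[M0 _]|[f mf sf]].
    by move: mv; rewrite M0 finset.in_set0.
  exact: saving_safe mf sf.
rewrite alt; have -> : (~~ to_move first (take i s) == player).
  by case: (to_move _ _) (player) tm => -[].
by move=> sf; exact: answer sf mv.
Qed.

End Strategy.

Theorem theorem1p1 (R : realType) (n : nat) (first player : bool) :
  exists sigma : seq {set 'I_n} -> {set 'I_n},
    is_strategy 3 first player sigma /\
    (forall s : seq {set 'I_n},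
       legal_play 3 s -> game_over 3 s -> follows first player sigma s ->
       planar R (position s)).
Proof.
exists (saving R (V := 'I_n)); split=> [s _ go _|s ls go fs]; first exact: saving_move.
have := saving_invariant ls fs (leqnn (size s)); rewrite take_size.
case: ifP => _; last exact: safe_planar.
by case=> [[]//|[f mf _]]; move: mf; rewrite go finset.in_set0.
Qed.
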